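(* Let $R>0$, let $f : B(0,R) \to \mathbb{H}$ be a non-constant regular function, and let $D_f$ be its degenerate set. Then the restriction $f: B(0,R)\setminus\overline{D_f}\to\mathbb{H}$ is open, i.e. it maps every open subset of $B(0,R)\setminus\overline{D_f}$ onto an open subset of $\mathbb{H}$.
   Context: $\mathbb{H}$ is the skew field of real quaternions, with the usual norm $|\cdot|$, and $B(0,R)=\{q\in\mathbb{H}:|q|<R\}$. Let $\mathbb{S}=\{q\in\mathbb{H}:q^2=-1\}$ be the 2-sphere of imaginary units and, for $I\in\mathbb{S}$, let $L_I=\mathbb{R}+I\mathbb{R}$. A real differentiable function $f:\Omega\to\mathbb{H}$ on a domain $\Omega\subseteq\mathbb{H}$ is called regular (Cullen-regular) if for every $I\in\mathbb{S}$ the restriction $f_I$ of $f$ to $\Omega\cap L_I$ satisfies $\frac12\left(\frac{\partial}{\partial x}+I\frac{\partial}{\partial y}\right)f_I(x+Iy)=0$ at every point $x+Iy$ of $\Omega\cap L_I$ ($x,y\in\mathbb{R}$). For $x,y\in\mathbb{R}$ write $x+y\mathbb{S}=\{x+yI:I\in\mathbb{S}\}$. The degenerate set $D_f$ of a regular function $f:B(0,R)\to\mathbb{H}$ is the union of all 2-spheres $x+y\mathbb{S}\subseteq B(0,R)$ ($x,y\in\mathbb{R}$, $y\neq0$) on which $f$ is constant; $\overline{D_f}$ denotes its closure. *)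

(* Defs.v *)
From HB Require Import structures.
From mathcomp Require Import all_boot all_order all_algebra.
From mathcomp Require Import ring lra.
From mathcomp Require Import all_classical all_reals all_analysis.

Set Implicit Arguments.
Unset Strict Implicit.
Unset Printing Implicit Defensive.

Import Order.TTheory GRing.Theory Num.Theory.
Import numFieldNormedType.Exports.

Local Open Scope classical_set_scope.
Local Open Scope ring_scope.

(* [Quat a b c d] is a + b i + c j + d k. *)
Record quat (R : realType) := Quat { qre : R; qi : R; qj : R; qk : R }.

Section quat_structures.
Variable R : realType.
Implicit Types p q s : quat R.

Lemma quat_eqP p q : qre p = qre q -> qi p = qi q -> qj p = qj q ->
  qk p = qk q -> p = q.
Proof. by case: p q => [a b c d] [a' b' c' d'] /= -> -> -> ->. Qed.

Definition quat_to_prod q : R * R * R * R := (qre q, qi q, qj q, qk q).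
Definition quat_of_prod (t : R * R * R * R) : quat R :=
  Quat t.1.1.1 t.1.1.2 t.1.2 t.2.

Lemma quat_to_prodK : cancel quat_to_prod quat_of_prod.
Proof. by case. Qed.

HB.instance Definition _ := Choice.copy (quat R) (can_type quat_to_prodK).

Definition addq p q :=
  Quat (qre p + qre q) (qi p + qi q) (qj p + qj q) (qk p + qk q).
Definition oppq p := Quat (- qre p) (- qi p) (- qj p) (- qk p).

Fact addqA : associative addq.
Proof. by move=> p q s; apply: quat_eqP => /=; rewrite addrA. Qed.
Fact addqC : commutative addq.
Proof. by move=> p q; apply: quat_eqP => /=; rewrite addrC. Qed.
Fact add0q : left_id (Quat 0 0 0 0) addq.
Proof. by move=> p; apply: quat_eqP => /=; rewrite add0r. Qed.
Fact addNq : left_inverse (Quat 0 0 0 0) oppq addq.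
Proof. by move=> p; apply: quat_eqP => /=; rewrite addNr. Qed.

HB.instance Definition _ :=
  GRing.isZmodule.Build (quat R) addqA addqC add0q addNq.

(* Hamilton product *)
Definition mulq p q :=
  Quat (qre p * qre q - qi p * qi q - qj p * qj q - qk p * qk q)
       (qre p * qi q + qi p * qre q + qj p * qk q - qk p * qj q)
       (qre p * qj q - qi p * qk q + qj p * qre q + qk p * qi q)
       (qre p * qk q + qi p * qj q - qj p * qi q + qk p * qre q).

Fact mulqA : associative mulq.
Proof. by move=> p q s; apply: quat_eqP => /=; ring. Qed.
Fact mul1q : left_id (Quat 1 0 0 0) mulq.
Proof. by move=> p; apply: quat_eqP => /=; ring. Qed.
Fact mulq1 : right_id (Quat 1 0 0 0) mulq.
Proof. by move=> p; apply: quat_eqP => /=; ring. Qed.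
Fact mulqDl : left_distributive mulq +%R.
Proof. by move=> p q s; apply: quat_eqP => /=; ring. Qed.
Fact mulqDr : right_distributive mulq +%R.
Proof. by move=> p q s; apply: quat_eqP => /=; ring. Qed.
Fact oneq_neq0 : Quat 1 0 0 0 != 0 :> quat R.
Proof. by apply/eqP => /(congr1 (@qre R)) /= /eqP; rewrite oner_eq0. Qed.

HB.instance Definition _ := GRing.Zmodule_isNzRing.Build (quat R)
  mulqA mul1q mulq1 mulqDl mulqDr oneq_neq0.

Definition scaleq (a : R) q := Quat (a * qre q) (a * qi q) (a * qj q) (a * qk q).

Fact scaleqA a b q : scaleq a (scaleq b q) = scaleq (a * b) q.
Proof. by apply: quat_eqP => /=; rewrite mulrA. Qed.
Fact scale1q : left_id 1 scaleq.
Proof. by move=> q; apply: quat_eqP => /=; rewrite mul1r. Qed.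
Fact scaleqDr : right_distributive scaleq +%R.
Proof. by move=> a p q; apply: quat_eqP => /=; rewrite mulrDr. Qed.
Fact scaleqDl q : {morph scaleq^~ q : a b / a + b}.
Proof. by move=> a b; apply: quat_eqP => /=; rewrite mulrDl. Qed.

HB.instance Definition _ := GRing.Zmodule_isLmodule.Build R (quat R)
  scaleqA scale1q scaleqDr scaleqDl.

Fact scaleqAl (a : R) p q : a *: (p * q) = (a *: p) * q.
Proof. by apply: quat_eqP => /=; ring. Qed.
Fact scaleqAr (a : R) p q : a *: (p * q) = p * (a *: q).
Proof. by apply: quat_eqP => /=; ring. Qed.

HB.instance Definition _ :=
  GRing.Lmodule_isLalgebra.Build R (quat R) scaleqAl.
HB.instance Definition _ :=
  GRing.Lalgebra_isAlgebra.Build R (quat R) scaleqAr.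

Definition normq q : R :=
  Num.sqrt (qre q ^+ 2 + qi q ^+ 2 + qj q ^+ 2 + qk q ^+ 2).

Let sqnq q := qre q ^+ 2 + qi q ^+ 2 + qj q ^+ 2 + qk q ^+ 2.

Let sqnq_ge0 q : 0 <= sqnq q.
Proof. by rewrite /sqnq !addr_ge0 ?sqr_ge0. Qed.

Fact ler_normqD p q : normq (p + q) <= normq p + normq q.
Proof.
have ge0 s : 0 <= normq s by exact: sqrtr_ge0.
rewrite -(@ler_pXn2r _ 2) ?nnegrE ?addr_ge0 // sqrrD !sqr_sqrtr ?sqnq_ge0 //.
pose d := qre p * qre q + qi p * qi q + qj p * qj q + qk p * qk q.
suff : d <= normq p * normq q by rewrite /d /= mulr2n; nra.
apply: (le_trans (ler_norm d)).
rewrite -(@ler_pXn2r _ 2) ?nnegrE ?mulr_ge0 // real_normK ?num_real //.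
rewrite exprMn !sqr_sqrtr ?sqnq_ge0 //.
rewrite -subr_ge0 /d.
set a := qre p; set b := qi p; set c := qj p; set e := qk p.
set a' := qre q; set b' := qi q; set c' := qj q; set e' := qk q.
have -> : (a ^+ 2 + b ^+ 2 + c ^+ 2 + e ^+ 2) *
    (a' ^+ 2 + b' ^+ 2 + c' ^+ 2 + e' ^+ 2) -
    (a * a' + b * b' + c * c' + e * e') ^+ 2 =
  (a * b' - b * a') ^+ 2 + (a * c' - c * a') ^+ 2 + (a * e' - e * a') ^+ 2 +
  (b * c' - c * b') ^+ 2 + (b * e' - e * b') ^+ 2 + (c * e' - e * c') ^+ 2.
  by ring.
by rewrite !addr_ge0 ?sqr_ge0.
Qed.

Fact normqZ (a : R) q : normq (a *: q) = `|a| * normq q.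
Proof.
rewrite /normq /= !exprMn -!mulrDr sqrtrM ?sqr_ge0 //.
by rewrite sqrtr_sqr.
Qed.

Fact normq0_eq0 q : normq q = 0 -> q = 0.
Proof.
move=> /eqP; rewrite sqrtr_eq0 => le0.
have := sqr_ge0 (qre q); have := sqr_ge0 (qi q).
have := sqr_ge0 (qj q); have := sqr_ge0 (qk q) => hk hj hi hr.
by apply: quat_eqP => /=; apply/eqP; rewrite -sqrf_eq0 eq_le sqr_ge0 andbT;
  lra.
Qed.

(* The topology of [quat R] is the one of this (Euclidean) norm. *)
HB.instance Definition _ := Lmodule_isNormed.Build R (quat R)
  ler_normqD normqZ normq0_eq0.

End quat_structures.

Section slice_regular.
Variable R : realType.
Implicit Types (q I : quat R) (f : quat R -> quat R) (A Omega : set (quat R)).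

Definition imag_units : set (quat R) := [set I | I ^+ 2 = -1].

(* A function on [Omega] is represented by any total extension of it; for open
   [Omega] the notions below depend only on the values on [Omega]. *)
Definition slice f I : R -> R -> quat R := fun x y => f (x%:A + I * y%:A).

Definition cullen_regular Omega f : Prop :=
  (forall q, Omega q -> differentiable f q) /\
  (forall I, imag_units I -> forall x y : R, Omega (x%:A + I * y%:A) ->
     2^-1 *: ('D_1 (slice f I ^~ y) x + I * 'D_1 (slice f I x) y) = 0).

Definition qsphere (x y : R) : set (quat R) :=
  [set x%:A + y%:A * I | I in imag_units].

Definition constant_on A f : Prop := exists c, forall q, A q -> f q = c.

Definition degenerate_set Omega f : set (quat R) :=
  \bigcup_(xy in [set xy : R * R | [/\ xy.2 != 0,
                    qsphere xy.1 xy.2 `<=` Omega &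
                    constant_on (qsphere xy.1 xy.2) f]])
    qsphere xy.1 xy.2.

(* Openness of the restriction of [f] to [A], for the subspace topology of [A]:
   the relatively open subsets of [A] are the [U `&` A] with [U] open. *)
Definition open_map_on A f : Prop :=
  forall U : set (quat R), open U -> open (f @` (U `&` A)).

Definition qball (r : R) : set (quat R) := [set q | `|q| < r].

End slice_regular.

(* Main.v *)
Require Import Defs.
From HB Require Import structures.
From mathcomp Require Import all_boot all_order all_algebra.
From mathcomp Require Import ring lra.
From mathcomp Require Import all_classical all_reals all_analysis.
From mathcomp Require Import complex.
Import Order.TTheory GRing.Theory Num.Theory.
Import numFieldNormedType.Exports.
Import ComplexField.Normc.
Local Open Scope classical_set_scope.
Local Open Scope ring_scope.

(** Write f (x + y I) = B (x, y) + I C (x, y) for every imaginary unit I. Such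
    functions B and C can be read off from the slices of i and - i, and the
    formula then holds for all I by the identity theorem, because both sides
    solve the regularity equation on the slice of I and agree on the real axis
    ([stem_slice]). The regularity equation becomes the Cauchy-Riemann
    equations for the pair (B, C), so the four complex-valued functions
    l (B) + i l (C), with l a real coordinate of the quaternions, are
    holomorphic on the disc of radius r.

    For a quaternion w consider the holomorphic function [symmetrization f w],
    the sum over l of the squares of l (B - w) + i l (C), that is
    |B - w|^2 - |C|^2 + 2 i <B - w, C>. It vanishes at x + i y if and only if
    - (B - w) C^-1 is an imaginary unit (or B = w and C = 0), which means that
    the sphere x + y S contains a point with f = w
    ([symmetrization_slice], [symmetrization_root]).

    Let now f q = c with q = x0 + y0 I0 outside the degenerate set. The
    symmetrization for c vanishes at z0 = x0 + i y0. It is not identically 0,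
    otherwise f = c on the real axis and hence everywhere; so z0 is an isolated
    zero ([symmetrization_isolated]). By Hurwitz's theorem the symmetrization
    for w has a zero z near z0 whenever w is close to c
    ([symmetrization_zero_stable]), and this gives a point p = x + y I with
    f p = w. The point p is close to q: since f is not constant on the sphere
    of q, C (z0) is not 0 unless y0 = 0, and then the equation B + I C = w
    determines I up to a small error ([regular_open_at]). Hence f maps
    neighbourhoods of q onto neighbourhoods of c.

    The one-variable theory is derived from real differentiability alone, for
    f is not assumed to be continuously differentiable: Goursat's bisection
    ([quadrisection], [green_rectangle]) makes integrals of closed forms
    homotopy invariant, which gives Cauchy's formula on circles
    ([cauchy_mean]). From it follow the identity theorem ([identity_disc]), by
    means of Taylor's formula with remainder, and Hurwitz's theorem
    ([zero_in_disc]), by means of the mean value property. *)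

Set Implicit Arguments.
Unset Strict Implicit.
Unset Printing Implicit Defensive.

Local Notation Re := complex.Re.
Local Notation Im := complex.Im.
Local Notation ii := (complex.Complex 0 1).
Local Open Scope complex_scope.

(** * Bisection of rectangles *)

Section rectangles.
Variable R : realType.

Lemma nested_intervals (u v : nat -> R) :
  (forall n, u n <= u n.+1) -> (forall n, v n.+1 <= v n) ->
  (forall n, u n <= v n) -> exists x, forall n, u n <= x <= v n.
Proof.
move=> uS vS uv.
have um : {homo u : m n / (m <= n)%N >-> m <= n}.
  by apply: homo_leq => //; exact: le_trans.
have vm : {homo v : m n / (m <= n)%N >-> n <= m}.
  by apply: homo_leq => // y x z xy yz; exact: le_trans yz xy.
have uvm m n : u m <= v n.
  by rewrite (le_trans (um _ _ (leq_maxl m n)))// (le_trans (uv _))// vm// leq_maxr.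
have ub n : ubound (range u) (v n) by move=> _ [m _ <-]; exact: uvm.
exists (sup (range u)) => n; apply/andP; split.
  apply: ub_le_sup; last by exists n.
  by exists (v 0%N); exact: ub.
by apply: ge_sup (ub n); exists (u 0%N); exists 0%N.
Qed.

Lemma half_interval (a b x k u : R) : 0 <= k -> a <= x -> x + (k + k) <= b ->
  u = x \/ u = x + k -> [/\ a <= u, u + k <= b, x <= u & u + k <= x + (k + k)].
Proof. by move=> ? ? ? [->|->]; split; lra. Qed.

Lemma quarter_share (f f1 f2 f3 f4 : R) : f <= f1 + f2 + f3 + f4 ->
  4 * f1 < f -> 4 * f2 < f -> 4 * f3 < f -> f <= 4 * f4.
Proof. lra. Qed.

(** If F does not vanish on the whole rectangle, then at each step some quarter
    carries at least a fourth of its size; the nested quarters shrink to a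
    point where F is o(s ^+ 2), although their sizes only decay like 4 ^- n.
    Here F x y s stands for an additive function of the rectangle with
    corner (x, y) and sides s * l and s * m. *)
Lemma quadrisection (F : R -> R -> R -> R) (a c l m : R) :
  0 <= l -> 0 <= m ->
  (forall x y s, 0 < s -> a <= x -> x + s * l <= a + l ->
     c <= y -> y + s * m <= c + m ->
     `|F x y s| <= `|F x y (s / 2)| + `|F (x + s / 2 * l) y (s / 2)| +
       `|F x (y + s / 2 * m) (s / 2)| +
       `|F (x + s / 2 * l) (y + s / 2 * m) (s / 2)|) ->
  (forall x0 y0 e, a <= x0 <= a + l -> c <= y0 <= c + m -> 0 < e ->
     exists2 d, 0 < d & forall x y s, 0 < s -> s < d ->
       a <= x -> x + s * l <= a + l -> c <= y -> y + s * m <= c + m ->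
       x <= x0 <= x + s * l -> y <= y0 <= y + s * m -> `|F x y s| <= e * s ^+ 2) ->
  F a c 1 = 0.
Proof.
move=> l0 m0 Fsub Floc.
pose s n : R := 2^-1 ^+ n.
have s0 n : 0 < s n by rewrite exprn_gt0.
have sS n : s n.+1 = s n / 2 by rewrite /s exprSr.
(* the rectangle of scale t at p lies in the given one *)
pose inr (p : R * R) t := [/\ a <= p.1, p.1 + t * l <= a + l, c <= p.2 & p.2 + t * m <= c + m].
have stepE (np : nat * (R * R)) : exists q : R * R, inr np.2 (s np.1) ->
    [/\ inr q (s np.1.+1), np.2.1 <= q.1,
        q.1 + s np.1.+1 * l <= np.2.1 + s np.1 * l,
        np.2.2 <= q.2 /\ q.2 + s np.1.+1 * m <= np.2.2 + s np.1 * m &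
        `|F np.2.1 np.2.2 (s np.1)| <= 4 * `|F q.1 q.2 (s np.1.+1)|].
  case: np => n [x y] /=.
  have [ins|nins] := pselect (inr (x, y) (s n)); last by exists (x, y).
  case: (ins) => /= h1 h2 h3 h4.
  have /= := Fsub _ _ _ (s0 n) h1 h2 h3 h4.
  rewrite sS; have t0 := s0 n; set t := s n in t0 h2 h4 *.
  have tl : 0 <= t / 2 * l by rewrite mulr_ge0// ltW// divr_gt0.
  have tm : 0 <= t / 2 * m by rewrite mulr_ge0// ltW// divr_gt0.
  have tlE : t * l = t / 2 * l + t / 2 * l by field.
  have tmE : t * m = t / 2 * m + t / 2 * m by field.
  rewrite tlE in h2; rewrite tmE in h4; rewrite tlE tmE => le4.
  suff [u [v [hu hv Fuv]]] : exists u v, [/\ u = x \/ u = x + t / 2 * l,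
      v = y \/ v = y + t / 2 * m & `|F x y t| <= 4 * `|F u v (t / 2)| ].
    have [u1 u2 u3 u4] := half_interval tl h1 h2 hu.
    have [v1 v2 v3 v4] := half_interval tm h3 h4 hv.
    by exists (u, v) => _; split.
  have [c1|c1] := lerP `|F x y t| (4 * `|F x y (t / 2)|).
    by exists x, y; split => //; left.
  have [c2|c2] := lerP `|F x y t| (4 * `|F (x + t / 2 * l) y (t / 2)|).
    by exists (x + t / 2 * l), y; split => //; [right|left].
  have [c3|c3] := lerP `|F x y t| (4 * `|F x (y + t / 2 * m) (t / 2)|).
    by exists x, (y + t / 2 * m); split => //; [left|right].
  exists (x + t / 2 * l), (y + t / 2 * m); split; [by right|by right|].
  exact: (quarter_share le4 c1 c2 c3).
have [g gE] := choice stepE.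
pose q := fix q n := if n is k.+1 then g (k, q k) else (a, c).
have qin n : inr (q n) (s n).
  elim: n => [|n IH]; first by rewrite /inr /= /s expr0 !mul1r.
  by have /= [] := gE (n, q n) IH.
have qx n := gE (n, q n) (qin n).
have [x0 x0P] : exists x, forall n, (q n).1 <= x <= (q n).1 + s n * l.
  apply: nested_intervals => n.
  - by have /= [] := qx n.
  - by have /= [] := qx n.
  - by rewrite lerDl mulr_ge0// ltW.
have [y0 y0P] : exists x, forall n, (q n).2 <= x <= (q n).2 + s n * m.
  apply: nested_intervals => n.
  - by have /= [_ _ _ []] := qx n.
  - by have /= [_ _ _ []] := qx n.
  - by rewrite lerDl mulr_ge0// ltW.
have Fn n : `|F a c 1| * s n ^+ 2 <= `|F (q n).1 (q n).2 (s n)|.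
  elim: n => [|n IH]; first by rewrite /s expr0 expr1n mulr1.
  have /= [_ _ _ _ h] := qx n.
  have := le_trans IH h; rewrite sS; set w := `|F a c 1|; set z := `|F (q n.+1).1 _ _|.
  rewrite -/(q n.+1) -/z => {}h.
  have -> : w * (s n / 2) ^+ 2 = w * s n ^+ 2 / 4 by field.
  by rewrite ler_pdivrMr//; lra.
apply/normr0_eq0; apply/eqP; rewrite eq_le normr_ge0 andbT.
apply/ler_addgt0Pl => e e0; rewrite addr0.
have x0in : a <= x0 <= a + l by have := x0P 0%N; rewrite /s expr0 mul1r.
have y0in : c <= y0 <= c + m by have := y0P 0%N; rewrite /s expr0 mul1r.
have [d d0 dP] := Floc _ _ _ x0in y0in e0.
have [n sn] : exists n, s n < d.
  have : (s @ \oo --> 0) by apply: cvg_expr; rewrite ger0_norm ?invf_lt1 ?ltr1n.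
  move/cvgrPdist_lt => /(_ _ d0) [n _ /(_ n)] /=.
  by rewrite sub0r normrN ger0_norm ?ltW// => h; exists n; apply: h.
have [h1 h2 h3 h4] := qin n.
have := dP _ _ _ (s0 n) sn h1 h2 h3 h4 (x0P n) (y0P n).
by move/(le_trans (Fn n)); rewrite ler_pM2r// exprn_gt0.
Qed.

End rectangles.

(** * Goursat's lemma for a closed form *)

Section integral.
Variable R : realType.
Notation mu := (@lebesgue_measure R).
Implicit Types (f g : R -> R) (a b : R).

Definition itg a b f : R := \int[mu]_(x in `[a, b]) f x.
Definition itv_continuous a b f := {within `[a, b], continuous f}.

Lemma itv_continuous_integrable a b f : itv_continuous a b f -> mu.-integrable `[a, b] (EFin \o f).
Proof. by move=> cf; apply: continuous_compact_integrable => //; exact: segment_compact. Qed.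

Lemma itg_linear a b f g k : itv_continuous a b f -> itv_continuous a b g ->
  itg a b (fun x => f x + k * g x) = itg a b f + k * itg a b g.
Proof.
move=> /itv_continuous_integrable cf /itv_continuous_integrable cg.
rewrite /itg RintegralD//; last by have := integrableZl _ k cg; apply.
by rewrite RintegralZl.
Qed.

Lemma itg_cst a b k : a <= b -> itg a b (fun=> k) = k * (b - a).
Proof.
move=> ab; rewrite /itg Rintegral_cst//= lebesgue_measure_itv/= lte_fin.
have [ab'|ba] := ltP a b; first by rewrite -EFinB.
have -> : a = b by apply/eqP; rewrite eq_le ab ba.
by rewrite subrr.
Qed.

Lemma itg_split a m b f : a <= m -> m <= b -> itv_continuous a b f ->
  itg a b f = itg a m f + itg m b f.
Proof.
move=> am mb /itv_continuous_integrable cf.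
rewrite /itg; apply/eqP; rewrite addrC -subr_eq; apply/eqP.
rewrite (Rintegral_itvB cf) ?bnd_simp// Rintegral_itv_obnd_cbnd//.
apply: integrableS cf => //; apply: subset_itvr; by rewrite bnd_simp.
Qed.

Lemma itv_continuousB a b f g : itv_continuous a b f -> itv_continuous a b g -> itv_continuous a b (fun x => f x - g x).
Proof. by move=> cf cg x; apply: cvgB; [exact: cf|exact: cg]. Qed.

Lemma itv_continuous_cst a b k : itv_continuous a b (fun=> k).
Proof. by apply: continuous_subspaceT => x; exact: cvg_cst. Qed.

Lemma itg_le_norm a b f k : a <= b -> itv_continuous a b f ->
  (forall x, a <= x <= b -> `|f x| <= k) -> `|itg a b f| <= k * (b - a).
Proof.
move=> ab cf fk.
have cif := itv_continuous_integrable cf.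
rewrite (le_trans (le_normr_Rintegral _ cif))// -itg_cst//.
apply: le_Rintegral => //.
- apply: (@itv_continuous_integrable _ _ (fun x => `|f x|)) => x; apply: cvg_norm; exact: cf.
- exact: (@itv_continuous_integrable _ _ (fun=> k) (@itv_continuous_cst _ _ _)).
Qed.

Lemma itgB a b f g : itv_continuous a b f -> itv_continuous a b g ->
  itg a b (fun x => f x - g x) = itg a b f - itg a b g.
Proof.
move=> cf cg; rewrite -mulN1r -itg_linear//; congr itg.
by apply/funext => x; rewrite mulN1r.
Qed.

Lemma itg_near_cst a b f k e : a <= b -> itv_continuous a b f ->
  (forall x, a <= x <= b -> `|f x - k| <= e) -> `|itg a b f - k * (b - a)| <= e * (b - a).
Proof.
move=> ab cf fk; rewrite -itg_cst// -itgB//; last exact: itv_continuous_cst.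
by apply: itg_le_norm => //; apply: itv_continuousB => //; exact: itv_continuous_cst.
Qed.

Lemma itg_opposite_edges a l f g k e : 0 <= l -> itv_continuous a (a + l) f -> itv_continuous a (a + l) g ->
  (forall x, a <= x <= a + l -> `|f x - g x - k| <= e) ->
  `|itg a (a + l) f - itg a (a + l) g - k * l| <= e * l.
Proof.
move=> l0 cf cg fgk; have al : a <= a + l by rewrite lerDl.
have := itg_near_cst al (itv_continuousB cf cg) fgk.
by rewrite itgB// [a + l]addrC addrK.
Qed.

End integral.

Section green.
Variable R : realType.
Implicit Types (P Q : R * R -> R) (p : R * R).

Definition pdiff P p (a b : R) := is_diff p P (fun v => a * v.1 + b * v.2).

Lemma pdiff_approx P p (a b e : R) : pdiff P p a b -> 0 < e ->
  exists2 d, 0 < d & forall x y, `|x - p.1| < d -> `|y - p.2| < d ->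
    `|P (x, y) - (P p + (a * (x - p.1) + b * (y - p.2)))| <= e * (`|x - p.1| + `|y - p.2|).
Proof.
move=> dP e0.
have /eqaddoP/(_ _ e0) := diff_locally (@ex_diff _ _ _ _ _ _ _ dP).
move=> /nbhs_ballP [d /= d0 hd]; exists d => // x y xd yd.
have {hd} := hd (x - p.1, y - p.2).
rewrite (@diff_val _ _ _ _ _ _ _ dP)/=.
rewrite /ball/= /prod_ball/= -!ball_normE/= !sub0r !normrN => /(_ (conj xd yd)).
rewrite !fctE /=.
have -> : (x - p.1, y - p.2) + p = (x, y).
  by rewrite [p]surjective_pairing; apply/eqP; rewrite xpair_eqE/= !subrK !eqxx.
move=> /le_trans; apply.
by rewrite ler_pM2l// prod_normE/= ge_max lerDl lerDr !normr_ge0.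
Qed.

Lemma pdiff_cont P p (a b : R) : pdiff P p a b -> {for p, continuous P}.
Proof.
by move=> dP; apply: differentiable_continuous; exact: (@ex_diff _ _ _ _ _ _ _ dP).
Qed.

Lemma section1_itv_continuous P (a b y : R) :
  (forall x, a <= x <= b -> {for (x, y), continuous P}) -> itv_continuous a b (fun x => P (x, y)).
Proof.
move=> cP; apply: continuous_in_subspaceT => x; rewrite inE/= in_itv/= => xab.
apply: (@continuous_comp _ _ _ (fun x => (x, y)) P); last exact: cP.
by apply: (@cvg_pair _ _ _ _ (nbhs x) (nbhs y)); [exact: cvg_id|exact: cvg_cst].
Qed.

Lemma section2_itv_continuous P (a b x : R) :
  (forall y, a <= y <= b -> {for (x, y), continuous P}) -> itv_continuous a b (fun y => P (x, y)).
Proof.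
move=> cP; apply: continuous_in_subspaceT => y; rewrite inE/= in_itv/= => yab.
apply: (@continuous_comp _ _ _ (fun y => (x, y)) P); last exact: cP.
by apply: (@cvg_pair _ _ _ _ (nbhs x) (nbhs y)); [exact: cvg_cst|exact: cvg_id].
Qed.

(** The integral of P dx + Q dy clockwise around the rectangle with corner (x,
    y) and sides l and m. *)
Definition boundary P Q (x y l m : R) : R :=
  itg x (x + l) (fun t => P (t, y + m)) - itg x (x + l) (fun t => P (t, y)) -
  (itg y (y + m) (fun t => Q (x + l, t)) - itg y (y + m) (fun t => Q (x, t))).

(** The inner edges are travelled twice, in opposite directions. *)
Lemma boundary_quarter P Q (x y l m : R) : 0 <= l -> 0 <= m ->
  (forall p, x <= p.1 <= x + (l + l) -> y <= p.2 <= y + (m + m) ->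
    {for p, continuous P} /\ {for p, continuous Q}) ->
  boundary P Q x y (l + l) (m + m) =
  boundary P Q x y l m + boundary P Q (x + l) y l m +
  boundary P Q x (y + m) l m + boundary P Q (x + l) (y + m) l m.
Proof.
move=> l0 m0 cPQ.
have sP t : y <= t <= y + (m + m) ->
  itg x (x + (l + l)) (fun u => P (u, t)) = itg x (x + l) (fun u => P (u, t)) +
   itg (x + l) (x + (l + l)) (fun u => P (u, t)).
  move=> ht; apply: itg_split; [lra|lra|].
  by apply: section1_itv_continuous => u hu; have [] := cPQ (u, t) hu ht.
have sQ t : x <= t <= x + (l + l) ->
  itg y (y + (m + m)) (fun u => Q (t, u)) = itg y (y + m) (fun u => Q (t, u)) +
   itg (y + m) (y + (m + m)) (fun u => Q (t, u)).
  move=> ht; apply: itg_split; [lra|lra|].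
  by apply: section2_itv_continuous => u hu; have [] := cPQ (t, u) ht hu.
rewrite /boundary !sP ?sQ; [|lra..].
rewrite -!addrA; ring.
Qed.

Lemma dist_in_segment (z w k t : R) : z <= w <= z + k -> z <= t <= z + k ->
  `|t - w| <= k.
Proof. by move=> zw zt; rewrite ler_norml; lra. Qed.

Lemma dist_differences (u v c d e : R) : `|u - c| <= e -> `|v - d| <= e ->
  `|u - v - (c - d)| <= 2 * e.
Proof. by rewrite !ler_norml => ? ?; lra. Qed.

Lemma segment_ends (x l : R) : 0 <= l -> x <= x <= x + l /\ x <= x + l <= x + l.
Proof. by move=> l0; split; lra. Qed.

(** Closedness of the form is used here: the number b is both dP/dy and dQ/dx,
    so the linear parts of P and Q contribute b * l * m to either pair of
    opposite edges and cancel, which leaves an error o((l + m) ^+ 2). *)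
Lemma boundary_small P Q p (a b g e : R) : pdiff P p a b -> pdiff Q p b g -> 0 < e ->
  exists2 d, 0 < d & forall x y l m, 0 <= l -> 0 <= m -> l < d -> m < d ->
    x <= p.1 <= x + l -> y <= p.2 <= y + m ->
    (forall p, x <= p.1 <= x + l -> y <= p.2 <= y + m ->
       {for p, continuous P} /\ {for p, continuous Q}) ->
    `|boundary P Q x y l m| <= e * (4 * (l + m) ^+ 2).
Proof.
move=> dP dQ e0.
have [d1 d10 h1] := pdiff_approx dP e0.
have [d2 d20 h2] := pdiff_approx dQ e0.
exists (Num.min d1 d2); first by rewrite lt_min d10.
move=> x y l m l0 m0; rewrite !lt_min => /andP[l1 l2] /andP[m1 m2] px py cPQ.
have hP s t : x <= s <= x + l -> y <= t <= y + m ->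
    `|P (s, t) - (P p + (a * (s - p.1) + b * (t - p.2)))| <= e * (l + m).
  move=> hs ht; have ds := dist_in_segment px hs; have dt := dist_in_segment py ht.
  have := h1 s t (le_lt_trans ds l1) (le_lt_trans dt m1).
  move=> /le_trans; apply.
  by rewrite ler_pM2l// lerD.
have hQ s t : x <= s <= x + l -> y <= t <= y + m ->
    `|Q (s, t) - (Q p + (b * (s - p.1) + g * (t - p.2)))| <= e * (l + m).
  move=> hs ht; have ds := dist_in_segment px hs; have dt := dist_in_segment py ht.
  have := h2 s t (le_lt_trans ds l2) (le_lt_trans dt m2).
  move=> /le_trans; apply.
  by rewrite ler_pM2l// lerD.
have [xx xl] := segment_ends x l0; have [yy ym] := segment_ends y m0.
have cP t : y <= t <= y + m -> itv_continuous x (x + l) (fun s => P (s, t)).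
  by move=> ht; apply: section1_itv_continuous => s hs; have [] := cPQ (s, t) hs ht.
have cQ s : x <= s <= x + l -> itv_continuous y (y + m) (fun t => Q (s, t)).
  by move=> hs; apply: section2_itv_continuous => t ht; have [] := cPQ (s, t) hs ht.
have I1 : `|itg x (x + l) (fun t => P (t, y + m)) - itg x (x + l) (fun t => P (t, y)) -
    b * m * l| <= 2 * (e * (l + m)) * l.
  apply: itg_opposite_edges => // [||s hs]; [exact: cP|exact: cP|].
  have := dist_differences (hP s (y + m) hs ym) (hP s y hs yy).
  by congr (`| _ - _ | <= _); ring.
have I2 : `|itg y (y + m) (fun t => Q (x + l, t)) - itg y (y + m) (fun t => Q (x, t)) -
    b * l * m| <= 2 * (e * (l + m)) * m.
  apply: itg_opposite_edges => // [||t ht]; [exact: cQ|exact: cQ|].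
  have := dist_differences (hQ (x + l) t xl ht) (hQ x t xx ht).
  by congr (`| _ - _ | <= _); ring.
rewrite /boundary.
move: I1 I2; set u := itg _ _ _ - itg _ _ _; set v := itg _ _ _ - itg _ _ _ => I1 I2.
have -> : u - v = (u - b * m * l) - (v - b * l * m) by ring.
apply: (le_trans (ler_normB _ _)); apply: (le_trans (lerD I1 I2)).
have -> : e * (4 * (l + m) ^+ 2) = (2 * (e * (l + m)) * l + 2 * (e * (l + m)) * m) * 2.
  by ring.
by rewrite ler_peMr ?ler1n// addr_ge0// !mulr_ge0 ?(ltW e0)// addr_ge0.
Qed.

(** Goursat's form of Green's theorem. The partial derivatives may be
    discontinuous, so the double integral of dQ/dx - dP/dy need not make
    sense; the bisection argument replaces it. *)
Lemma green_rectangle P Q (a b c d : R) : a <= b -> c <= d ->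
  (forall p, a <= p.1 <= b -> c <= p.2 <= d ->
    exists p1 p2 q2 : R, pdiff P p p1 p2 /\ pdiff Q p p2 q2) ->
  itg a b (fun t => P (t, d)) - itg a b (fun t => P (t, c)) =
  itg c d (fun t => Q (b, t)) - itg c d (fun t => Q (a, t)).
Proof.
move=> ab cd dPQ.
have cPQ p : a <= p.1 <= b -> c <= p.2 <= d ->
    {for p, continuous P} /\ {for p, continuous Q}.
  move=> h1 h2; have [p1 [p2 [q2 [h3 h4]]]] := dPQ p h1 h2.
  by split; [exact: pdiff_cont h3|exact: pdiff_cont h4].
apply/eqP; rewrite -subr_eq0; apply/eqP.
pose l := b - a; pose m := d - c.
have l0 : 0 <= l by rewrite subr_ge0.
have m0 : 0 <= m by rewrite subr_ge0.
have bE : b = a + 1 * l by rewrite /l; ring.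
have dE : d = c + 1 * m by rewrite /m; ring.
rewrite bE dE.
rewrite -/(boundary P Q a c (1 * l) (1 * m)).
apply: (@quadrisection _ (fun x y s => boundary P Q x y (s * l) (s * m)) a c l m) => //.
  move=> x y s s0 ax xb cy yd.
  have sl : 0 <= s / 2 * l by rewrite mulr_ge0// divr_ge0// ltW.
  have sm : 0 <= s / 2 * m by rewrite mulr_ge0// divr_ge0// ltW.
  have -> : s * l = s / 2 * l + s / 2 * l by field.
  have -> : s * m = s / 2 * m + s / 2 * m by field.
  rewrite boundary_quarter//.
    by do 3 ![apply: le_trans (ler_normD _ _) _; rewrite lerD2r].
  have slE : s * l = s / 2 * l + s / 2 * l by field.
  have smE : s * m = s / 2 * m + s / 2 * m by field.
  by move=> p h1 h2; apply: cPQ; rewrite ?bE ?dE; lra.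
move=> x0 y0 e ha hc e0.
have hx0 : a <= (x0, y0).1 <= b by rewrite /= bE mul1r.
have hy0 : c <= (x0, y0).2 <= d by rewrite /= dE mul1r.
have [p1 [p2 [q2 [h3 h4]]]] := dPQ (x0, y0) hx0 hy0.
pose k := 4 * (l + m) ^+ 2 + 1.
have k0 : 0 < k by rewrite ltr_wpDl// mulr_ge0// sqr_ge0.
have [d' d'0 hd] := boundary_small h3 h4 (divr_gt0 e0 k0).
pose n := l + m + 1.
have n0 : 0 < n by rewrite /n; lra.
exists (d' / n); first exact: divr_gt0.
move=> x y s s0; rewrite ltr_pdivlMr// => sd ax xb cy yd xx0 yy0.
have sl : 0 <= s * l by rewrite mulr_ge0// ltW.
have sm : 0 <= s * m by rewrite mulr_ge0// ltW.
have := hd x y (s * l) (s * m) sl sm.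
have -> : s * l < d' by move: sd; rewrite /n; lra.
have -> : s * m < d' by move: sd; rewrite /n; lra.
move=> /(_ isT isT xx0 yy0) h.
have {}h : `|boundary P Q x y (s * l) (s * m)| <= e / k * (4 * (s * l + s * m) ^+ 2).
  by apply: h => p h1 h2; apply: cPQ; rewrite ?bE ?dE; lra.
apply: (le_trans h).
have -> : e / k * (4 * (s * l + s * m) ^+ 2) = e * s ^+ 2 * (4 * (l + m) ^+ 2 / k).
  by ring.
apply: ler_piMr; first by rewrite mulr_ge0 ?sqr_ge0// ltW.
by rewrite ler_pdivrMr// mul1r /k lerDl.
Qed.

End green.

(** * Complex-valued functions of two real variables *)

Section real_partials.
Variable R : realType.

Lemma is_diff_linear (V W : normedModType R) (f : V -> W) (x : V) :
  linear f -> continuous f -> is_diff x f f.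
Proof.
move=> lf cf.
pose F : {linear V -> W} := HB.pack f (GRing.isLinear.Build R V W *:%R f lf).
by apply: DiffDef; [exact: (@linear_differentiable _ _ _ F)|exact: (@diff_lin _ _ _ F)].
Qed.

Implicit Types (P Q : R * R -> R) (p : R * R).

Lemma pdiff_cst p (k : R) : pdiff (fun=> k) p 0 0.
Proof.
apply: (is_diff_eq (is_diff_cst k p)).
by apply/funext => v /=; rewrite !mul0r addr0.
Qed.

Lemma pdiff_fst p : pdiff fst p 1 0.
Proof.
apply: is_diff_eq; first apply: is_diff_linear => //.
  by move=> x; exact: cvg_fst.
by apply/funext => v /=; rewrite mul0r addr0 mul1r.
Qed.

Lemma pdiff_snd p : pdiff snd p 0 1.
Proof.
apply: is_diff_eq; first apply: is_diff_linear => //.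
  by move=> x; exact: cvg_snd.
by apply/funext => v /=; rewrite mul0r add0r mul1r.
Qed.

Lemma pdiff_eq P p (a b a' b' : R) : pdiff P p a b -> a = a' -> b = b' -> pdiff P p a' b'.
Proof. by move=> ? <- <-. Qed.

Lemma pdiffD P Q p (a b c d : R) : pdiff P p a b -> pdiff Q p c d ->
  pdiff (fun v => P v + Q v) p (a + c) (b + d).
Proof.
move=> dP dQ; apply: (is_diff_eq (is_diffD dP dQ)).
by apply/funext => v; rewrite !fctE; ring.
Qed.

Lemma pdiffB P Q p (a b c d : R) : pdiff P p a b -> pdiff Q p c d ->
  pdiff (fun v => P v - Q v) p (a - c) (b - d).
Proof.
move=> dP dQ; apply: (is_diff_eq (is_diffB dP dQ)).
by apply/funext => v; rewrite !fctE; ring.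
Qed.

Lemma pdiffM P Q p (a b c d : R) : pdiff P p a b -> pdiff Q p c d ->
  pdiff (fun v => P v * Q v) p (P p * c + Q p * a) (P p * d + Q p * b).
Proof.
move=> dP dQ; apply: (is_diff_eq (is_diffM dP dQ)).
apply/funext => v; rewrite !fctE /GRing.scale/=; ring.
Qed.

Lemma pdiffV P p (a b : R) : P p != 0 -> pdiff P p a b ->
  pdiff (fun v => (P v)^-1) p (- a / P p ^+ 2) (- b / P p ^+ 2).
Proof.
move=> P0 dP; have eP := @ex_diff _ _ _ _ _ _ _ dP.
apply: DiffDef; first exact: differentiableV.
rewrite diffV// (@diff_val _ _ _ _ _ _ _ dP).
apply/funext => v /=; rewrite /GRing.scale/=; ring.
Qed.

Lemma pdiff_comp P (u v : R * R -> R) p (a b u1 u2 v1 v2 : R) :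
  pdiff u p u1 u2 -> pdiff v p v1 v2 -> pdiff P (u p, v p) a b ->
  pdiff (fun t => P (u t, v t)) p (a * u1 + b * v1) (a * u2 + b * v2).
Proof.
move=> du dv dP.
apply: (is_diff_eq (is_diff_comp (is_diff_pair du dv) dP)).
apply/funext => t /=; ring.
Qed.

Lemma pdiff_snd_comp (f : R -> R) p (d : R) : is_derive p.2 1 f d ->
  pdiff (fun t => f t.2) p 0 d.
Proof.
move=> df.
have fd : differentiable f p.2 by apply/derivable1_diffP.
have h : is_diff (p.2) f (fun t => t * d).
  apply: DiffDef => //; rewrite diff1E//; apply/funext => t.
  by rewrite derive1E derive_val.
apply: (is_diff_eq (is_diff_comp (pdiff_snd p) h)).
apply/funext => t /=; ring.
Qed.

End real_partials.

Section complex_partials.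
Variable R : realType.
Notation C := R[i].
Implicit Types (F G : R * R -> C) (p : R * R) (x y z : C).

Lemma cReD x y : Re (x + y) = Re x + Re y. Proof. by case: x y => [a b] [c d]. Qed.
Lemma cImD x y : Im (x + y) = Im x + Im y. Proof. by case: x y => [a b] [c d]. Qed.
Lemma cReB x y : Re (x - y) = Re x - Re y. Proof. by case: x y => [a b] [c d]. Qed.
Lemma cImB x y : Im (x - y) = Im x - Im y. Proof. by case: x y => [a b] [c d]. Qed.
Lemma cReM x y : Re (x * y) = Re x * Re y - Im x * Im y. Proof. by case: x y => [a b] [c d]. Qed.
Lemma cImM x y : Im (x * y) = Re x * Im y + Im x * Re y. Proof. by case: x y => [a b] [c d]. Qed.
Lemma cReV x : Re x^-1 = Re x / (Re x ^+ 2 + Im x ^+ 2). Proof. by case: x. Qed.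
Lemma cImV x : Im x^-1 = - Im x / (Re x ^+ 2 + Im x ^+ 2). Proof. by case: x => a b /=; rewrite mulNr. Qed.
Lemma complex_ext x y : Re x = Re y -> Im x = Im y -> x = y.
Proof. by case: x y => [a b] [c d] /= -> ->. Qed.

Lemma sqn_neq0 x : x != 0 -> Re x ^+ 2 + Im x ^+ 2 != 0.
Proof.
apply: contra; rewrite paddr_eq0 ?sqr_ge0// !sqrf_eq0 => /andP[/eqP a /eqP b].
by apply/eqP/complex_ext.
Qed.

Definition cdiff F p (a b : C) :=
  pdiff (fun v => Re (F v)) p (Re a) (Re b) /\ pdiff (fun v => Im (F v)) p (Im a) (Im b).

Lemma cdiff_eq F p a b a' b' : cdiff F p a b -> a = a' -> b = b' -> cdiff F p a' b'.
Proof. by move=> ? <- <-. Qed.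

Lemma cdiff_cst p k : cdiff (fun=> k) p 0 0.
Proof. by split; exact: pdiff_cst. Qed.

Lemma cdiffD F G p a b c d : cdiff F p a b -> cdiff G p c d ->
  cdiff (fun v => F v + G v) p (a + c) (b + d).
Proof.
move=> [F1 F2] [G1 G2]; split.
  under [X in pdiff X]funext do rewrite cReD.
  by rewrite !cReD; exact: pdiffD.
under [X in pdiff X]funext do rewrite cImD.
by rewrite !cImD; exact: pdiffD.
Qed.

Lemma cdiffB F G p a b c d : cdiff F p a b -> cdiff G p c d ->
  cdiff (fun v => F v - G v) p (a - c) (b - d).
Proof.
move=> [F1 F2] [G1 G2]; split.
  under [X in pdiff X]funext do rewrite cReB.
  by rewrite !cReB; exact: pdiffB.
under [X in pdiff X]funext do rewrite cImB.
by rewrite !cImB; exact: pdiffB.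
Qed.

Lemma cdiffM F G p a b c d : cdiff F p a b -> cdiff G p c d ->
  cdiff (fun v => F v * G v) p (F p * c + G p * a) (F p * d + G p * b).
Proof.
move=> [F1 F2] [G1 G2]; split.
  under [X in pdiff X]funext do rewrite cReM.
  by apply: pdiff_eq; [apply: pdiffB; apply: pdiffM; eassumption
    |rewrite !(cReD, cReM); ring|rewrite !(cReD, cReM); ring].
under [X in pdiff X]funext do rewrite cImM.
by apply: pdiff_eq; [apply: pdiffD; apply: pdiffM; eassumption
    |rewrite !(cImD, cImM); ring|rewrite !(cImD, cImM); ring].
Qed.

Lemma cdiffV F p a b : F p != 0 -> cdiff F p a b ->
  cdiff (fun v => (F v)^-1) p (- a / F p ^+ 2) (- b / F p ^+ 2).
Proof.
move=> F0 [F1 F2]; have N0 := sqn_neq0 F0.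
have h : pdiff (fun v => Re (F v) * Re (F v) + Im (F v) * Im (F v)) p _ _ :=
  pdiffD (pdiffM F1 F1) (pdiffM F2 F2).
have {h} := pdiffV _ h; rewrite -!expr2 => /(_ N0) h.
rewrite expr2 invfM !mulrA; split.
  under [X in pdiff X]funext do rewrite cReV !expr2.
  by apply: pdiff_eq; [apply: pdiffM; [exact: F1|exact: h]
    |rewrite !(cReM, cImM, cReV, cImV) !raddfN/=; field..].
under [X in pdiff X]funext do rewrite cImV !expr2 mulNr -mulrN -[- _^-1]sub0r.
by apply: pdiff_eq; [apply: pdiffM; [exact: F2|apply: pdiffB (pdiff_cst _ 0) h]
    |rewrite !(cReM, cImM, cReV, cImV) !raddfN/=; field..].
Qed.

(** The hypothesis on h is complex differentiability at F p with derivative d,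
    so that the chain rule multiplies both partial derivatives of F by d. *)
Lemma cdiff_comp (h : C -> C) F p a b d :
  cdiff (fun v => h (v.1 +i* v.2)) (Re (F p), Im (F p)) d (ii * d) ->
  cdiff F p a b -> cdiff (fun v => h (F v)) p (d * a) (d * b).
Proof.
move=> [h1 h2] [F1 F2].
have FE v : F v = Re (F v) +i* Im (F v) by case: (F v).
have H1 := pdiff_comp F1 F2 h1; have H2 := pdiff_comp F1 F2 h2.
split.
  rewrite (_ : (fun v => Re (h (F v))) =
    fun t => Re (h ((Re (F t), Im (F t)).1 +i* (Re (F t), Im (F t)).2))).
    apply: pdiff_eq H1 _ _; rewrite !cReM/=; ring.
  by apply/funext => v /=; rewrite -FE.
rewrite (_ : (fun v => Im (h (F v))) =
    fun t => Im (h ((Re (F t), Im (F t)).1 +i* (Re (F t), Im (F t)).2))).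
  apply: pdiff_eq H2 _ _; rewrite !cImM/=; ring.
by apply/funext => v /=; rewrite -FE.
Qed.

(** The Cauchy-Riemann equations in complex form: d/dy = i d/dx. *)
Definition holo (h : C -> C) z :=
  exists d, cdiff (fun v => h (v.1 +i* v.2)) (Re z, Im z) d (ii * d).

Lemma holo_cst k z : holo (fun=> k) z.
Proof. by exists 0; rewrite mulr0; exact: cdiff_cst. Qed.

Lemma cdiff_id p : cdiff (fun v => v.1 +i* v.2) p 1 ii.
Proof.
split.
  by apply: pdiff_eq; [exact: pdiff_fst|rewrite /=; ring..].
by apply: pdiff_eq; [exact: pdiff_snd|rewrite /=; ring..].
Qed.

Lemma holo_id z : holo id z.
Proof. by exists 1; rewrite mulr1; exact: cdiff_id. Qed.

Lemma complex_eta x : Re x +i* Im x = x. Proof. by case: x. Qed.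

Variables f g : C -> C.

Lemma holoD z : holo f z -> holo g z -> holo (fun w => f w + g w) z.
Proof.
move=> [c hc] [d hd]; exists (c + d).
by apply: cdiff_eq (cdiffD hc hd) _ _; ring.
Qed.

Lemma holoB z : holo f z -> holo g z -> holo (fun w => f w - g w) z.
Proof.
move=> [c hc] [d hd]; exists (c - d).
by apply: cdiff_eq (cdiffB hc hd) _ _; ring.
Qed.

Lemma holoM z : holo f z -> holo g z -> holo (fun w => f w * g w) z.
Proof.
move=> [c hc] [d hd]; exists (f z * d + g z * c).
by apply: cdiff_eq (cdiffM hc hd) _ _; rewrite /= complex_eta; ring.
Qed.

Lemma holoV z : f z != 0 -> holo f z -> holo (fun w => (f w)^-1) z.
Proof.
move=> fz [c hc]; exists (- c / f z ^+ 2).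
apply: cdiff_eq (cdiffV _ hc) _ _; rewrite /= complex_eta//; ring.
Qed.

End complex_partials.

(** * Circle means and Cauchy's formula *)

Section modulus.
Variable R : realType.
Notation C := R[i].
Implicit Types x y z : C.

Lemma normc_ge0 x : 0 <= normc x. Proof. by case: x => a b; exact: sqrtr_ge0. Qed.
Lemma normcR (a : R) : normc a%:C = `|a|.
Proof. by rewrite /= expr0n addr0 sqrtr_sqr. Qed.
Lemma normc_sqr x : normc x ^+ 2 = Re x ^+ 2 + Im x ^+ 2.
Proof. by case: x => a b /=; rewrite sqr_sqrtr// addr_ge0// sqr_ge0. Qed.
Lemma Re_le x : `|Re x| <= normc x.
Proof.
rewrite -(@ler_pXn2r _ 2)// ?nnegrE ?normc_ge0// real_normK ?num_real//.
by rewrite normc_sqr lerDl sqr_ge0.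
Qed.
Lemma Im_le x : `|Im x| <= normc x.
Proof.
rewrite -(@ler_pXn2r _ 2)// ?nnegrE ?normc_ge0// real_normK ?num_real//.
by rewrite normc_sqr lerDr sqr_ge0.
Qed.
Lemma normc_le_ReIm x : normc x <= `|Re x| + `|Im x|.
Proof.
rewrite -(@ler_pXn2r _ 2)// ?nnegrE ?normc_ge0 ?addr_ge0// normc_sqr.
rewrite sqrrD !real_normK ?num_real// addrAC lerDl.
by rewrite mulrn_wge0// mulr_ge0.
Qed.
Lemma normc_opp x : normc (- x) = normc x. Proof. exact: normcN. Qed.
Lemma normc_triangle x y : normc (x + y) <= normc x + normc y. Proof. exact: le_normcD. Qed.
Lemma normcB x y : normc (x - y) = normc (y - x).
Proof. by rewrite -normc_opp opprB. Qed.
Lemma le_normcB x y : normc (x - y) <= normc x + normc y.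
Proof. by rewrite -(normc_opp y); exact: normc_triangle. Qed.
Lemma le_distc x y : normc x - normc y <= normc (x - y).
Proof. by rewrite lerBlDr -{1}[x](subrK y); exact: normc_triangle. Qed.
Lemma normc_gt0 x : x != 0 -> 0 < normc x.
Proof. by move=> x0; rewrite lt_def normc_ge0 andbT; apply: contra x0 => /eqP/eq0_normc ->. Qed.
Lemma normcX x n : normc (x ^+ n) = normc x ^+ n.
Proof. by elim: n => [|n IH]; rewrite ?expr0 ?normc1// !exprS normcM IH. Qed.

Lemma holo_near (h : C -> C) z e : holo h z -> 0 < e ->
  exists2 d, 0 < d & forall w, normc (w - z) < d -> normc (h w - h z) < e.
Proof.
move=> [d [h1 h2]] e0.
have e2 : 0 < e / 2 by exact: divr_gt0.
have /cvgrPdist_lt/(_ _ e2)/nbhs_ballP[d1 /= d10 H1] := pdiff_cont h1.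
have /cvgrPdist_lt/(_ _ e2)/nbhs_ballP[d2 /= d20 H2] := pdiff_cont h2.
exists (Num.min d1 d2); first by rewrite lt_min d10.
move=> w; rewrite lt_min => /andP[w1 w2].
have := H1 (Re w, Im w); have := H2 (Re w, Im w).
rewrite /ball/= /prod_ball/= -!ball_normE/= -!cReB -!cImB.
rewrite (normcB w) in w1 w2.
move=> /(_ (conj (le_lt_trans (Re_le _) w2) (le_lt_trans (Im_le _) w2))) A2.
move=> /(_ (conj (le_lt_trans (Re_le _) w1) (le_lt_trans (Im_le _) w1))) A1.
rewrite normcB; apply: (le_lt_trans (normc_le_ReIm _)).
rewrite cReB cImB [e]splitr.
by move: A1 A2; rewrite !complex_eta -cReB -cImB => *; rewrite ltrD.
Qed.

End modulus.

Section circle.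
Variable R : realType.
Notation C := R[i].
Implicit Types (phi psi : R -> C) (z w : C) (h : C -> C).

Definition ccontinuous phi :=
  continuous (fun t => Re (phi t)) /\ continuous (fun t => Im (phi t)).

Lemma ccontinuous_cst k : ccontinuous (fun=> k).
Proof. by split => t; exact: cvg_cst. Qed.

Lemma ccontinuousD phi psi : ccontinuous phi -> ccontinuous psi ->
  ccontinuous (fun t => phi t + psi t).
Proof.
move=> [a b] [c d]; split => t.
  by under [X in continuous_at _ X]funext do rewrite cReD; apply: cvgD; [exact: a|exact: c].
by under [X in continuous_at _ X]funext do rewrite cImD; apply: cvgD; [exact: b|exact: d].
Qed.

Lemma ccontinuousB phi psi : ccontinuous phi -> ccontinuous psi ->
  ccontinuous (fun t => phi t - psi t).
Proof.
move=> [a b] [c d]; split => t.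
  by under [X in continuous_at _ X]funext do rewrite cReB; apply: cvgB; [exact: a|exact: c].
by under [X in continuous_at _ X]funext do rewrite cImB; apply: cvgB; [exact: b|exact: d].
Qed.

Lemma ccontinuousM phi psi : ccontinuous phi -> ccontinuous psi ->
  ccontinuous (fun t => phi t * psi t).
Proof.
move=> [a b] [c d]; split => t.
  under [X in continuous_at _ X]funext do rewrite cReM.
  by apply: cvgB; apply: cvgM; [exact: a|exact: c|exact: b|exact: d].
under [X in continuous_at _ X]funext do rewrite cImM.
by apply: cvgD; apply: cvgM; [exact: a|exact: d|exact: b|exact: c].
Qed.

Lemma ccontinuousV phi : (forall t, phi t != 0) -> ccontinuous phi ->
  ccontinuous (fun t => (phi t)^-1).
Proof.
move=> phi0 [a b].
have n t : (fun t => (Re (phi t) ^+ 2 + Im (phi t) ^+ 2)^-1) @ t -->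
    (Re (phi t) ^+ 2 + Im (phi t) ^+ 2)^-1.
  apply: cvgV; first exact: sqn_neq0.
  by apply: cvgD; under eq_fun do rewrite expr2; rewrite expr2; apply: cvgM;
    by [exact: a|exact: b].
split => t.
  by under [X in continuous_at _ X]funext do rewrite cReV; apply: cvgM; [exact: a|exact: n].
under [X in continuous_at _ X]funext do rewrite cImV; apply: cvgM; last exact: n.
by apply: cvgN; exact: b.
Qed.

Lemma ccontinuous_comp h phi : ccontinuous phi -> (forall t, holo h (phi t)) ->
  ccontinuous (fun t => h (phi t)).
Proof.
move=> [a b] hh.
have E t : phi t = Re (phi t) +i* Im (phi t) by rewrite complex_eta.
split => t; have [d [h1 h2]] := hh t.
  under [X in continuous_at _ X]funext do rewrite E.
  apply: (@continuous_comp _ _ _ (fun t => (Re (phi t), Im (phi t)))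
    (fun v => Re (h (v.1 +i* v.2)))); last exact: pdiff_cont h1.
  by apply: (@cvg_pair _ _ _ _ (nbhs (Re (phi t))) (nbhs (Im (phi t)))); [exact: a|exact: b].
under [X in continuous_at _ X]funext do rewrite E.
apply: (@continuous_comp _ _ _ (fun t => (Re (phi t), Im (phi t)))
    (fun v => Im (h (v.1 +i* v.2)))); last exact: pdiff_cont h2.
by apply: (@cvg_pair _ _ _ _ (nbhs (Re (phi t))) (nbhs (Im (phi t)))); [exact: a|exact: b].
Qed.

Definition expi (t : R) : C := cos t +i* sin t.

Lemma normc_expi t : normc (expi t) = 1.
Proof. by rewrite /= cos2Dsin2 sqrtr1. Qed.

Lemma expi_neq0 t : expi t != 0.
Proof. by apply/eqP => /(congr1 (@normc R)); rewrite normc_expi normc0; lra. Qed.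

Lemma expi_period : expi (pi *+ 2) = expi 0.
Proof. by rewrite /expi cos2pi sin2pi cos0 sin0. Qed.

Lemma ccontinuous_expi : ccontinuous expi.
Proof. by split => t; [exact: continuous_cos|exact: continuous_sin]. Qed.

Lemma twopi_gt0 : 0 < pi *+ 2 :> R.
Proof. by rewrite mulrn_wgt0// pi_gt0. Qed.

Definition cmean phi : C :=
  ((pi *+ 2)^-1 * itg 0 (pi *+ 2) (fun t => Re (phi t))) +i*
  ((pi *+ 2)^-1 * itg 0 (pi *+ 2) (fun t => Im (phi t))).

Lemma cmean_cst k : cmean (fun=> k) = k.
Proof.
have p0 := lt0r_neq0 twopi_gt0.
rewrite /cmean !itg_cst ?ltW ?twopi_gt0// subr0.
by apply: complex_ext => /=; rewrite mulrC mulfK.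
Qed.

Lemma itv_continuous_linear (a b k : R) (f g : R -> R) : itv_continuous a b f -> itv_continuous a b g ->
  itv_continuous a b (fun x => f x + k * g x).
Proof.
move=> cf cg x; apply: cvgD; first exact: cf.
by apply: cvgM; [exact: cvg_cst|exact: cg].
Qed.

Lemma cmean_linear k phi psi : ccontinuous phi -> ccontinuous psi ->
  cmean (fun t => phi t + k * psi t) = cmean phi + k * cmean psi.
Proof.
move=> [a b] [c d].
have ac := @continuous_subspaceT _ _ `[0, pi *+ 2] _ a.
have bc := @continuous_subspaceT _ _ `[0, pi *+ 2] _ b.
have cc := @continuous_subspaceT _ _ `[0, pi *+ 2] _ c.
have dc := @continuous_subspaceT _ _ `[0, pi *+ 2] _ d.
apply: complex_ext => /=.
  under [X in itg _ _ X]funext do rewrite cReD cReM addrA -mulNr.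
  rewrite (@itg_linear _ _ _ (fun t => Re (phi t) + Re k * Re (psi t)))//; last first.
    exact: itv_continuous_linear.
  rewrite itg_linear// cReD cReM /=; ring.
under [X in itg _ _ X]funext do rewrite cImD cImM addrA.
rewrite (@itg_linear _ _ _ (fun t => Im (phi t) + Re k * Im (psi t)))//; last first.
  exact: itv_continuous_linear.
rewrite itg_linear// cImD cImM /=; ring.
Qed.

Lemma cmeanZ k psi : ccontinuous psi -> cmean (fun t => k * psi t) = k * cmean psi.
Proof.
move=> cpsi; rewrite -[RHS]add0r -(cmean_cst 0) -cmean_linear//; last exact: ccontinuous_cst.
by congr cmean; apply/funext => t; rewrite add0r.
Qed.

Lemma cmeanB phi psi : ccontinuous phi -> ccontinuous psi ->
  cmean (fun t => phi t - psi t) = cmean phi - cmean psi.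
Proof.
move=> cphi cpsi; rewrite -mulN1r -cmean_linear//.
by congr cmean; apply/funext => t; rewrite mulN1r.
Qed.

(** The factor 2 is the price of estimating the real and imaginary parts
    separately. *)
Lemma cmean_le phi s : ccontinuous phi ->
  (forall t, 0 <= t <= pi *+ 2 -> normc (phi t) <= s) ->
  normc (cmean phi) <= 2 * s.
Proof.
move=> [a b] hs.
have p0 := twopi_gt0.
have ac := @continuous_subspaceT _ _ `[0, pi *+ 2] _ a.
have bc := @continuous_subspaceT _ _ `[0, pi *+ 2] _ b.
apply: (le_trans (normc_le_ReIm _)) => /=.
rewrite mulr2n mulrDl mul1r; apply: lerD.
  rewrite normrM gtr0_norm ?invr_gt0// mulrC ler_pdivrMr//.
  by have := itg_le_norm (ltW p0) ac (fun x xt => le_trans (Re_le _) (hs x xt)); rewrite subr0.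
rewrite normrM gtr0_norm ?invr_gt0// mulrC ler_pdivrMr//.
by have := itg_le_norm (ltW p0) bc (fun x xt => le_trans (Im_le _) (hs x xt)); rewrite subr0.
Qed.

(** The form P dt + Q dtheta is closed on [0, 1] x [0, 2 pi], and the integrals
    along the edges theta = 0 and theta = 2 pi cancel by periodicity. *)
Lemma green_cmean (P Q : R * R -> C) :
  (forall p, 0 <= p.1 <= 1 -> 0 <= p.2 <= pi *+ 2 ->
    exists a b d, cdiff P p a b /\ cdiff Q p b d) ->
  (forall t, P (t, pi *+ 2) = P (t, 0)) ->
  cmean (fun t => Q (0, t)) = cmean (fun t => Q (1, t)).
Proof.
move=> dPQ per; have p0 := ltW twopi_gt0.
have gR := @green_rectangle R (fun p => Re (P p)) (fun p => Re (Q p)) 0 1 0 (pi *+ 2) ler01 p0.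
have gI := @green_rectangle R (fun p => Im (P p)) (fun p => Im (Q p)) 0 1 0 (pi *+ 2) ler01 p0.
apply: complex_ext => /=; congr (_ * _); apply/esym/eqP; rewrite -subr_eq0.
  rewrite -gR; last first.
    move=> p h1 h2; have [a [b [d [[? _] [? _]]]]] := dPQ p h1 h2.
    by exists (Re a), (Re b), (Re d).
  by under [X in itg _ _ X - _]funext do rewrite per; rewrite subrr.
rewrite -gI; last first.
  move=> p h1 h2; have [a [b [d [[_ ?] [_ ?]]]]] := dPQ p h1 h2.
  by exists (Im a), (Im b), (Im d).
by under [X in itg _ _ X - _]funext do rewrite per; rewrite subrr.
Qed.

Lemma cdiff_expi p : cdiff (fun v => expi v.2) p 0 (ii * expi p.2).
Proof.
split.
  apply: pdiff_eq; first by apply: (@pdiff_snd_comp _ cos); exact: is_derive_cos.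
    by [].
  by rewrite /= !mul0r mul1r sub0r.
apply: pdiff_eq; first by apply: (@pdiff_snd_comp _ sin); exact: is_derive_sin.
  by [].
by rewrite /= !mul0r mul1r add0r.
Qed.

Lemma cdiff_fst (p : R * R) : cdiff (fun v => (v.1)%:C) p 1 0.
Proof. by split; [exact: pdiff_fst|exact: pdiff_cst]. Qed.

(** Up to the factor 2 pi i, both sides are integrals of the form h(w) / (w - z)
    dw, along the circle of radius r about 0 and the circle of radius e
    about z. The linear homotopy gam between these circles stays in the
    closed disc of radius r, and it avoids z because e <= r - |z|. *)
Lemma circle_mean_deformation h (r e : R) z : 0 < r -> 0 < e -> normc z + e <= r ->
  (forall w, normc w <= r -> holo h w) ->
  cmean (fun t => h (r%:C * expi t) * (r%:C * expi t) / (r%:C * expi t - z)) =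
  cmean (fun t => h (z + e%:C * expi t)).
Proof.
move=> r0 e0 zer hh.
pose rad (v : R * R) : C := r%:C + (e - r)%:C * (v.1)%:C.
(* gam is the homotopy, gam1 and gam2 its partial derivatives; k(w) dw pulls
   back to P dt + Q dtheta *)
pose gam (v : R * R) : C := z * (v.1)%:C + rad v * expi v.2.
pose gam1 (v : R * R) : C := z + (e - r)%:C * expi v.2.
pose gam2 (v : R * R) : C := rad v * (ii * expi v.2).
pose k (w : C) := h w / (w - z).
have drad p : cdiff rad p (e - r)%:C 0.
  apply: cdiff_eq (cdiffD (cdiff_cst p _) (cdiffM (cdiff_cst p _) (cdiff_fst p))) _ _; ring.
have dgam p : cdiff gam p (gam1 p) (gam2 p).
  have dz := cdiffM (cdiff_cst p z) (cdiff_fst p).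
  have de := cdiffM (drad p) (cdiff_expi p).
  by apply: cdiff_eq (cdiffD dz de) _ _; rewrite /gam1 /gam2; ring.
have dgam1 p : cdiff gam1 p 0 ((e - r)%:C * (ii * expi p.2)).
  apply: cdiff_eq (cdiffD (cdiff_cst p _) (cdiffM (cdiff_cst p _) (cdiff_expi p))) _ _; ring.
have dgam2 p : cdiff gam2 p ((e - r)%:C * (ii * expi p.2)) (- (rad p * expi p.2)).
  apply: cdiff_eq (cdiffM (drad p) (cdiffM (cdiff_cst p ii) (cdiff_expi p))) _ _; first ring.
  have i2 : ii * ii = -1 :> C by rewrite -expr2 sqr_i.
  by rewrite !mulr0 !addr0 [ii * (ii * _)]mulrA i2; ring.
pose P v := k (gam v) * gam1 v; pose Q v := k (gam v) * gam2 v.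
have radE v : rad v = (r + (e - r) * v.1)%:C by apply: complex_ext => /=; ring.
have creexp (c : C) : ccontinuous (fun t => c * expi t).
  by apply: ccontinuousM; [exact: ccontinuous_cst|exact: ccontinuous_expi].
have cze : ccontinuous (fun t => z + e%:C * expi t).
  by apply: ccontinuousD => //; exact: ccontinuous_cst.
have nre t : normc (r%:C * expi t) = r by rewrite normcM normc_expi mulr1 normcR gtr0_norm.
have zr : normc z < r by lra.
have nz t : z <> r%:C * expi t by move=> ze; move: zr; rewrite ze nre ltxx.
have nze t : normc (z + e%:C * expi t) <= r.
  apply: (le_trans (normc_triangle _ _)).
  by rewrite normcM normc_expi mulr1 normcR gtr0_norm.
have ii0 : ii != 0 :> C.
  by apply/eqP => /(congr1 (fun x : C => Im x)) /= /eqP; rewrite oner_eq0.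
have := @green_cmean P Q.
have -> : (fun t => Q (0, t)) = fun t =>
    ii * (h (r%:C * expi t) * (r%:C * expi t) / (r%:C * expi t - z)).
  apply/funext => t.
  have r0E : rad (0, t) = r%:C by rewrite radE /= mulr0 addr0.
  have g0E : gam (0, t) = r%:C * expi t by rewrite /gam r0E /= -[0%:C]/(0 : C) mulr0 add0r.
  rewrite /Q /k /gam2 g0E r0E; ring.
have -> : (fun t => Q (1, t)) = fun t => ii * h (z + e%:C * expi t).
  apply/funext => t.
  have r1E : rad (1, t) = e%:C by rewrite radE /=; congr (_ %:C); ring.
  have g1E : gam (1, t) = z + e%:C * expi t by rewrite /gam r1E /= -[1%:C]/(1 : C) mulr1.
  rewrite /Q /k /gam2 g1E r1E.
  have e1 : z + e%:C * expi t - z = e%:C * expi t by ring.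
  rewrite e1.
  have e2 : e%:C * expi t != 0.
    by rewrite mulf_neq0 ?expi_neq0// (inj_eq (@complexI R)) gt_eqF.
  have -> (a b c : C) : a / b * (e%:C * (ii * c)) = ii * (a * (e%:C * c) / b) by ring.
  by rewrite mulfK.
have ck : ccontinuous (fun t => h (r%:C * expi t) * (r%:C * expi t) / (r%:C * expi t - z)).
  apply: ccontinuousM.
    apply: ccontinuousM => //; apply: (ccontinuous_comp (creexp _)) => t.
    by apply: hh; rewrite nre.
  apply: ccontinuousV => [t|]; first by rewrite subr_eq0; apply/eqP => /esym; exact: nz.
  by apply: ccontinuousB => //; exact: ccontinuous_cst.
have ch : ccontinuous (fun t => h (z + e%:C * expi t)).
  by apply: (ccontinuous_comp cze) => t; apply: hh; exact: nze.
rewrite !cmeanZ// => gr.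
apply: (mulfI ii0); apply: gr => [p p1 p2|t]; last by rewrite /P /gam1 /gam /= expi_period.
have [hg gz] : normc (gam p) <= r /\ gam p != z.
  case: p p1 p2 => t u /= t01 _.
  have rad0 : 0 <= r + (e - r) * t by nra.
  have rz : (1 - t) * normc z < r + (e - r) * t by nra.
  rewrite /gam radE /=; split.
    apply: (le_trans (normc_triangle _ _)).
    rewrite !normcM normc_expi !normcR (ger0_norm rad0) mulr1 ger0_norm; last lra.
    have : 0 <= t * (r - (normc z + e)) by rewrite mulr_ge0//; lra.
    lra.
  apply/eqP => E.
  have : normc ((1 - t)%:C * z) = r + (e - r) * t.
    have -> : (1 - t)%:C * z = z - z * t%:C.
      by rewrite rmorphB rmorph1; ring.
    by rewrite -{1}E addrAC subrr add0r normcM normc_expi mulr1 normcR ger0_norm.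
  by rewrite normcM normcR ger0_norm; [move=> E2; move: rz; rewrite E2 ltxx|lra].
have [d dk] : holo k (gam p).
  apply: holoM; first exact: hh.
  by apply: holoV; [rewrite subr_eq0|apply: holoB; [exact: holo_id|exact: holo_cst]].
have dkg := cdiff_comp dk (dgam p).
do 3 eexists; split; first exact: (cdiffM dkg (dgam1 p)).
by apply: cdiff_eq (cdiffM dkg (dgam2 p)) _ _; [ring|reflexivity].
Qed.

(** Cauchy's formula, obtained by letting the small circle shrink to z. For z =
    0 it is the mean value property. *)
Lemma cauchy_mean h (r : R) z : 0 < r -> normc z < r ->
  (forall w, normc w <= r -> holo h w) ->
  h z = cmean (fun t => h (r%:C * expi t) * (r%:C * expi t) / (r%:C * expi t - z)).
Proof.
move=> r0 zr hh.
have hz := hh _ (ltW zr).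
apply/eqP; rewrite eq_sym -subr_eq0; apply/eqP/eq0_normc/eqP.
rewrite eq_le normc_ge0 andbT; apply/ler_addgt0Pl => s s0; rewrite addr0.
have [d d0 hd] := holo_near hz (divr_gt0 s0 (ltr0n R 2)).
pose e := Num.min (d / 2) (r - normc z).
have e0 : 0 < e by rewrite lt_min divr_gt0//= subr_gt0.
have ed : e < d by rewrite gt_min ltr_pdivrMr// mulr2n mulrDr mulr1 ltrDl d0.
have er : normc z + e <= r by rewrite -lerBrDl ge_min lexx orbT.
rewrite (circle_mean_deformation r0 e0 er hh).
have nze t : normc (e%:C * expi t) = e.
  by rewrite normcM normc_expi mulr1 normcR gtr0_norm.
have ch : ccontinuous (fun t => h (z + e%:C * expi t)).
  apply: (@ccontinuous_comp h (fun t => z + e%:C * expi t)) => [|t].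
    apply: ccontinuousD; first exact: ccontinuous_cst.
    by apply: ccontinuousM; [exact: ccontinuous_cst|exact: ccontinuous_expi].
  by apply: hh; apply: (le_trans (normc_triangle _ _)); rewrite nze.
rewrite -(cmean_cst (h z)) -cmeanB//; last exact: ccontinuous_cst.
rewrite [leRHS](_ : s = 2 * (s / 2)); last by field.
apply: cmean_le => [|t _].
  by apply: ccontinuousB => //; exact: ccontinuous_cst.
by apply/ltW/hd; rewrite addrAC subrr add0r nze.
Qed.

End circle.

(** * Zeros of holomorphic functions *)

Section zeros.
Variable R : realType.
Notation C := R[i].
Implicit Types (h : C -> C) (z w : C).

Lemma ccontinuous_normc (phi : R -> C) : ccontinuous phi ->
  continuous (fun t => normc (phi t)).
Proof.
move=> [a b] t.
pose n2 t := Re (phi t) * Re (phi t) + Im (phi t) * Im (phi t).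
have -> : (fun t => normc (phi t)) = fun t => Num.sqrt (n2 t).
  by apply/funext => u; rewrite /n2; case: (phi u) => x y; rewrite /normc !expr2.
apply: (@continuous_comp _ _ _ n2); last exact: sqrt_continuous.
by apply: cvgD; apply: cvgM; by [exact: a|exact: b].
Qed.

Lemma ccontinuous_bounded (phi : R -> C) : ccontinuous phi ->
  exists2 s, 0 <= s & forall t, 0 <= t <= pi *+ 2 -> normc (phi t) <= s.
Proof.
move=> /ccontinuous_normc/continuous_subspaceT cn.
have [c _ hc] := EVT_max (ltW (@twopi_gt0 R)) (cn _).
by exists (normc (phi c)) => [|t ht]; [exact: normc_ge0|apply: hc; rewrite in_itv].
Qed.

Lemma ccontinuous_min (phi : R -> C) : ccontinuous phi -> (forall t, phi t != 0) ->
  exists2 s, 0 < s & forall t, 0 <= t <= pi *+ 2 -> s <= normc (phi t).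
Proof.
move=> /ccontinuous_normc/continuous_subspaceT cn phi0.
have [c _ hc] := EVT_min (ltW (@twopi_gt0 R)) (cn _).
by exists (normc (phi c)) => [|t ht]; [exact: normc_gt0|apply: hc; rewrite in_itv].
Qed.

Definition zeros_cluster h z := forall e : R, 0 < e ->
  exists w, [/\ w != z, normc (w - z) < e & h w = 0].

(** Expanding the Cauchy kernel k times, w / (w - z) = 1 + (z / w) w / (w - z),
    gives Taylor's formula with coefficients a k and remainders z ^+ k * rem
    k z. Zeros near 0 force the coefficients to vanish one after the other,
    and then h z is bounded by a constant times (|z| / r) ^+ k for every k. *)
Lemma zeros_cluster_disc0 h (r : R) : 0 < r ->
  (forall w, normc w <= r -> holo h w) -> zeros_cluster h 0 ->
  forall z, normc z < r -> h z = 0.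
Proof.
move=> r0 hh acc.
pose W (t : R) : C := r%:C * expi t.
have nW t : normc (W t) = r by rewrite normcM normc_expi mulr1 normcR gtr0_norm.
have W0 t : W t != 0.
  by apply/eqP => E; have := nW t; rewrite E normc0 => r00; rewrite r00 ltxx in r0.
have cW : ccontinuous W.
  by apply: ccontinuousM; [exact: ccontinuous_cst|exact: ccontinuous_expi].
have cWV : ccontinuous (fun t => (W t)^-1) by exact: ccontinuousV.
have chW : ccontinuous (fun t => h (W t)).
  by apply: (ccontinuous_comp cW) => t; apply: hh; rewrite nW.
have cX k : ccontinuous (fun t => (W t)^-1 ^+ k).
  elim: k => [|k IH]; first exact: ccontinuous_cst.
  under [X in ccontinuous X]funext do rewrite exprS; exact: ccontinuousM.
have Wz z t : normc z < r -> W t - z != 0.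
  by move=> zr; rewrite subr_eq0; apply/eqP => E; move: zr; rewrite -E nW ltxx.
have cK z : normc z < r -> ccontinuous (fun t => W t / (W t - z)).
  move=> zr; apply: ccontinuousM => //; apply: ccontinuousV => [t|]; first exact: Wz.
  by apply: ccontinuousB => //; exact: ccontinuous_cst.
(* Taylor remainders and coefficients of h on the circle of radius r *)
pose rem k z := cmean (fun t => h (W t) * (W t)^-1 ^+ k * (W t / (W t - z))).
pose a k := cmean (fun t => h (W t) * (W t)^-1 ^+ k).
have ca k : ccontinuous (fun t => h (W t) * (W t)^-1 ^+ k) by exact: ccontinuousM.
have cr k z : normc z < r ->
    ccontinuous (fun t => h (W t) * (W t)^-1 ^+ k * (W t / (W t - z))).
  by move=> zr; apply: ccontinuousM => //; exact: cK.
have remS k z : normc z < r -> rem k z = a k + z * rem k.+1 z.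
  move=> zr; rewrite /rem /a -cmean_linear//; last exact: cr.
  congr cmean; apply/funext => t; rewrite exprS.
  have := W0 t; have := Wz z t zr; set w := W t => w1 w2.
  by move: ((w^-1) ^+ k) => u; field; rewrite ?w1 ?w2.
have [s s0 hs] := ccontinuous_bounded chW.
have remB k z : normc z < r -> normc (rem k z) <= 2 * (s * r^-1 ^+ k * (r / (r - normc z))).
  move=> zr; apply: cmean_le => [|t ht]; first exact: cr.
  rewrite normcM normcM [normc (W t / _)]normcM normcX !normcV nW.
  have rV0 : 0 <= r^-1 ^+ k by rewrite exprn_ge0// invr_ge0 ltW.
  apply: ler_pM.
  - by rewrite mulr_ge0// normc_ge0.
  - by rewrite divr_ge0 ?normc_ge0// ltW.
  - by apply: ler_wpM2r => //; exact: hs.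
  rewrite ler_pM2l// lef_pV2 ?posrE ?subr_gt0//; last by apply: normc_gt0; exact: Wz.

  by have := le_distc (W t) z; rewrite nW.
have main k z : normc z < r -> h z = z ^+ k * rem k z.
  elim: k z => [z zr|k IH z zr].
    rewrite expr0 mul1r /rem (cauchy_mean r0 zr hh).
    by congr cmean; apply/funext => t; rewrite expr0 mulr1 -mulrA.
  suff ak0 : a k = 0 by rewrite IH// remS// ak0 add0r exprSr mulrA.
  apply: contrapT => /eqP ak0; have na := normc_gt0 ak0.
  pose K := 2 * (s * r^-1 ^+ k.+1 * 2).
  have K0 : 0 <= K by rewrite !mulr_ge0// exprn_ge0// invr_ge0 ltW.
  have e0 : 0 < Num.min (r / 2) (normc (a k) / (K + 1)).
    by rewrite lt_min !divr_gt0// ltr_wpDl.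
  have [w [w0]] := acc _ e0; rewrite subr0 lt_min => /andP[wr wa] hw.
  have wr' : normc w < r by lra.
  have := IH w wr'; rewrite hw => /esym/eqP; rewrite mulf_eq0 expf_eq0 (negPf w0) andbF/=.
  rewrite remS// addr_eq0 => /eqP akE.
  have : normc (a k) <= normc w * K.
    rewrite akE normc_opp normcM; apply: ler_wpM2l; first exact: normc_ge0.
    apply: (le_trans (remB _ _ wr')); rewrite /K ler_pM2l//.
    apply: ler_wpM2l; first by rewrite mulr_ge0// exprn_ge0// invr_ge0 ltW.
    by rewrite ler_pdivrMr; lra.
  move: wa; rewrite ltr_pdivlMr ?ltr_wpDl// mulrDr mulr1.
  have := normc_gt0 w0; lra.
move=> z zr; apply: contrapT => /eqP/normc_gt0 hz.
pose K := 2 * (s * (r / (r - normc z))).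
have K0 : 0 <= K by rewrite !mulr_ge0 ?invr_ge0 ?subr_ge0 ?(ltW zr)// ltW.
pose q := normc z / r.
have q0 : 0 <= q by rewrite divr_ge0 ?normc_ge0// ltW.
have q1 : q < 1 by rewrite ltr_pdivrMr// mul1r.
have hq k : normc (h z) <= q ^+ k * K.
  rewrite (main k z zr) normcM normcX.
  apply: (le_trans (ler_wpM2l (exprn_ge0 _ (normc_ge0 _)) (remB k z zr))).
  by rewrite /q /K expr_div_n exprVn le_eqVlt; apply/orP; left; apply/eqP; ring.
have d0 : 0 < normc (h z) / (K + 1) by rewrite divr_gt0// ltr_wpDl.
have : ((fun k => q ^+ k) @ \oo --> 0) by apply: cvg_expr; rewrite ger0_norm.
move/cvgrPdist_lt => /(_ _ d0) [n _ /(_ n (leqnn n))] /=.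
rewrite sub0r normrN ger0_norm ?exprn_ge0// ltr_pdivlMr ?ltr_wpDl// mulrDr mulr1.
by have := hq n; have := exprn_ge0 n q0; lra.
Qed.

Lemma holo_shift h z0 z : holo h (z0 + z) -> holo (fun w => h (z0 + w)) z.
Proof.
move=> [d dh]; exists d.
have dF := cdiffD (cdiff_cst (Re z, Im z) z0) (cdiff_id (Re z, Im z)).
have := @cdiff_comp _ h _ _ _ _ d _ dF.
rewrite /= complex_eta !add0r mulr1 [d * ii]mulrC; exact.
Qed.

Lemma zeros_cluster_disc h z0 (r : R) :
  (forall w, normc (w - z0) < r -> holo h w) -> zeros_cluster h z0 ->
  forall z, normc (z - z0) < r -> h z = 0.
Proof.
move=> hh acc z zr.
pose s := (normc (z - z0) + r) / 2.
have zs : normc (z - z0) < s by rewrite ltr_pdivlMr//; lra.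
have sr : s < r by rewrite ltr_pdivrMr//; lra.
have := @zeros_cluster_disc0 (fun w => h (z0 + w)) s _ _ _ (z - z0) zs.
have zE (v : C) : z0 + (v - z0) = v by ring.
rewrite /= zE; apply.
- by apply: le_lt_trans zs; exact: normc_ge0.
- move=> w ws; apply: holo_shift; apply: hh.
  by rewrite addrAC subrr add0r (le_lt_trans ws).
- move=> e e0; have [w [w0 we hw]] := acc e e0; exists (w - z0).
  by rewrite subr_eq0 subr0 zE.
Qed.

(** A chain of discs: if zeros cluster at w, then h vanishes on the disc of
    radius r - |w| about w, which contains points closer to the origin by
    the fixed amount d, and zeros cluster at these too. After finitely many
    steps, counted by n, the origin is reached, where the disc is the whole
    domain. *)
Lemma identity_disc h (r : R) z0 : (forall w, normc w < r -> holo h w) ->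
  normc z0 < r -> zeros_cluster h z0 -> forall z, normc z < r -> h z = 0.
Proof.
move=> hh z0r acc z zr.
have [d d0 dE] : exists2 d, 0 < d & r - normc z0 = d + d.
  by exists ((r - normc z0) / 2); [rewrite divr_gt0// subr_gt0|field].
suff main n w : normc w <= n%:R * d -> normc w <= normc z0 -> zeros_cluster h w -> h z = 0.
  have [n hn] : exists n : nat, normc z0 / d < n%:R.
    exists (Num.truncn (normc z0 / d)).+1.
    by rewrite truncnS_gt.
  by apply: (main n z0) => //; rewrite -ler_pdivrMr// ltW.
elim: n w => [w w0 _ accw|n IH w wn wz accw].
  have w00 : w = 0.
    by apply/eq0_normc/eqP; rewrite eq_le normc_ge0 andbT; move: w0; rewrite mul0r.
  apply: (@zeros_cluster_disc h 0 r); rewrite ?subr0 -?w00//.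
  by move=> u; rewrite w00 subr0; exact: hh.
have hw u : normc (u - w) < r - normc w -> h u = 0.
  apply: zeros_cluster_disc => // v vw; apply: hh.
  by rewrite -[v](subrK w); apply: (le_lt_trans (normc_triangle _ _)); lra.
(* the next centre: w moved by d towards the origin, or the origin itself *)
have [u [un uz uw]] : exists u, [/\ normc u <= n%:R * d, normc u <= normc z0 &
    normc (u - w) <= d].
  have [wd|dw] := lerP (normc w) d.
    exists 0; rewrite normc0 sub0r normc_opp.
    by split; rewrite ?mulr_ge0 ?ler0n ?normc_ge0 ?(ltW d0).
  have nw0 : 0 < normc w by exact: lt_trans dw.
  pose c := 1 - d / normc w.
  have c0 : 0 <= c by rewrite subr_ge0 ler_pdivrMr// mul1r ltW.
  have cw : c * normc w = normc w - d by rewrite /c; field; exact: lt0r_neq0.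
  exists (c%:C * w); rewrite normcM normcR ger0_norm// cw.
  split; [move: wn; rewrite -natr1; lra|lra|].
  have -> : c%:C * w - w = - ((d / normc w)%:C * w) by rewrite /c rmorphB rmorph1; ring.
  rewrite normc_opp normcM normcR ger0_norm ?divr_ge0 ?(ltW d0) ?(ltW nw0)//.
  by rewrite mulfVK// lt0r_neq0.
apply: (IH u un uz) => e e0.
pose f := Num.min (e / 2) (d / 2).
have f0 : 0 < f by rewrite lt_min !divr_gt0.
have fe : f < e by rewrite gt_min; apply/orP; left; lra.
have fd : f < d by rewrite gt_min; apply/orP; right; lra.
exists (u + f%:C).
have -> : u + f%:C - u = f%:C by ring.
rewrite normcR gtr0_norm// -subr_eq0; split => //.
  have -> : u + f%:C - u = f%:C by ring.
  by rewrite (inj_eq (@complexI R)) gt_eqF.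
apply: hw; have -> : u + f%:C - w = (u - w) + f%:C by ring.
apply: (le_lt_trans (normc_triangle _ _)); rewrite normcR gtr0_norm//; lra.
Qed.

(** A quantitative form of Hurwitz's theorem: if h had no zero in the disc, the
    mean value property of 1 / h would give 1 / |h z0| <= 2 / m. *)
Lemma zero_in_disc h z0 (r m : R) : 0 < r ->
  (forall w, normc (w - z0) <= r -> holo h w) ->
  (forall t, 0 <= t <= pi *+ 2 -> m <= normc (h (z0 + r%:C * expi t))) ->
  2 * normc (h z0) < m -> exists2 w, normc (w - z0) <= r & h w = 0.
Proof.
move=> r0 hh hm h0; apply: contrapT => nz.
have hn0 w : normc (w - z0) <= r -> h w != 0.
  by move=> wr; apply/eqP => hw; apply: nz; exists w.
pose g u := (h (z0 + u))^-1.
have hg u : normc u <= r -> holo g u.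
  move=> ur; have zu : normc (z0 + u - z0) <= r by rewrite addrAC subrr add0r.
  by apply: holoV; [exact: hn0|apply: holo_shift; exact: hh].
have n0r : normc (0 : C) < r by rewrite normc0.
have gE := cauchy_mean r0 n0r hg.
have nre t : normc (r%:C * expi t) = r by rewrite normcM normc_expi mulr1 normcR gtr0_norm.
have : normc (g 0) <= 2 * m^-1.
  have m0 : 0 < m by apply: le_lt_trans h0; rewrite mulr_ge0// normc_ge0.
  have nz0 t : r%:C * expi t != 0.
    by apply/eqP => E; have := nre t; rewrite E normc0 => E'; rewrite E' ltxx in r0.
  rewrite gE; under [X in cmean X]funext => t do rewrite subr0 mulfK//.
  apply: cmean_le => [|t ht].
    apply: (@ccontinuous_comp _ g (fun t => r%:C * expi t)) => [|t].
      by apply: ccontinuousM; [exact: ccontinuous_cst|exact: ccontinuous_expi].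
    by apply: hg; rewrite nre.
  rewrite /g normcV lef_pV2 ?posrE//; first exact: hm.
  by apply: lt_le_trans (hm _ ht).
have m0 : 0 < m by apply: le_lt_trans h0; rewrite mulr_ge0// normc_ge0.
have hz : 0 < normc (h z0) by apply: normc_gt0; apply: hn0; rewrite subrr normc0 ltW.
rewrite /g addr0 normcV ler_pdivlMr// mulrC ler_pdivrMr// => hh2.
by move: h0; rewrite ltNge hh2.
Qed.

End zeros.

(** * Algebra and geometry of the quaternions *)

Section quaternion_algebra.
Variable R : realType.
Implicit Types (p q I J : quat R).

Definition sqnorm q : R := qre q ^+ 2 + qi q ^+ 2 + qj q ^+ 2 + qk q ^+ 2.
Definition qconj q : quat R := Quat (qre q) (- qi q) (- qj q) (- qk q).

Lemma sqnormE q : sqnorm q = `|q| ^+ 2.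
Proof. by rewrite sqr_sqrtr// !addr_ge0 ?sqr_ge0. Qed.

Lemma qnormM p q : `|p * q| = `|p| * `|q|.
Proof.
apply/eqP; rewrite -(@eqrXn2 _ 2) ?mulr_ge0// exprMn -!sqnormE; apply/eqP.
by rewrite /sqnorm /=; ring.
Qed.

(** The imaginary units form the unit sphere of the space of purely imaginary
    quaternions. *)
Lemma imag_unitP I : imag_units I <-> qre I = 0 /\ sqnorm I = 1.
Proof.
split=> [|[I0 I1]].
  rewrite /imag_units/= expr2 => h.
  have [h1 h2 h3 h4] : [/\ qre (I * I) = -1, qi (I * I) = 0, qj (I * I) = 0 & qk (I * I) = 0].
    by rewrite h /=; split => //; rewrite oppr0.
  move: h1 h2 h3 h4; case: (I) => a b c d; rewrite /sqnorm /= => h1 h2 h3 h4.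
  suff a0 : a = 0 by split => //; rewrite a0 in h1 *; lra.
  apply: contrapT => /eqP a0.
  have z x : a * x + x * a = 0 -> x = 0.
    rewrite [x * a]mulrC -mulr2n => /eqP; rewrite mulrn_eq0/= mulf_eq0 (negPf a0)/=.
    by move/eqP.
  have b0 : b = 0 by apply: z; lra.
  have c0 : c = 0 by apply: z; lra.
  have d0 : d = 0 by apply: z; lra.
  by move: h1; rewrite b0 c0 d0; nra.
move: I0 I1; rewrite /imag_units/= /sqnorm expr2; case: (I) => a b c d /= -> h.
by apply: quat_eqP => /=; rewrite ?oppr0; lra.
Qed.

Lemma imag_unit_norm I : imag_units I -> `|I| = 1.
Proof.
move=> /imag_unitP[_ h]; apply/eqP; rewrite -(@eqrXn2 _ 2)// -sqnormE h expr1n//.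
Qed.

Lemma imag_unit_mul I q : imag_units I -> I * (I * q) = - q.
Proof. by move=> h; rewrite mulrA -expr2 h mulN1r. Qed.

Lemma norm_slice_point I x y : imag_units I -> `|x%:A + I * y%:A| = normc (x +i* y).
Proof.
move=> /imag_unitP[h0 h1]; apply/eqP; rewrite -(@eqrXn2 _ 2) ?normc_ge0//.
rewrite -sqnormE normc_sqr /sqnorm /=; apply/eqP.
move: h0 h1; case: (I) => a b c d; rewrite /sqnorm /= => -> h.
have -> : x ^+ 2 + y ^+ 2 = x ^+ 2 + y ^+ 2 * (0 ^+ 2 + b ^+ 2 + c ^+ 2 + d ^+ 2).
  by rewrite h mulr1.
ring.
Qed.

Lemma exists_slice q : exists I x y, imag_units I /\ q = x%:A + I * y%:A.
Proof.
pose n := Num.sqrt (qi q ^+ 2 + qj q ^+ 2 + qk q ^+ 2).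
have n2 : n ^+ 2 = qi q ^+ 2 + qj q ^+ 2 + qk q ^+ 2.
  by rewrite sqr_sqrtr// !addr_ge0 ?sqr_ge0.
have [n0|n0] := eqVneq n 0.
  exists (Quat 0 1 0 0), (qre q), 0; split.
    by apply/imag_unitP; rewrite /sqnorm/=; split => //; ring.
  move: n2; rewrite n0 => n2.
  have := sqr_ge0 (qi q); have := sqr_ge0 (qj q); have := sqr_ge0 (qk q) => k0 j0 i0.
  have z (x : R) : x ^+ 2 = 0 -> x = 0 by move/eqP; rewrite sqrf_eq0 => /eqP.
  have qi0 : qi q = 0 by apply: z; lra.
  have qj0 : qj q = 0 by apply: z; lra.
  have qk0 : qk q = 0 by apply: z; lra.
  by apply: quat_eqP => /=; rewrite ?qi0 ?qj0 ?qk0; ring.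
exists (n^-1 *: Quat 0 (qi q) (qj q) (qk q)), (qre q), n; split.
  apply/imag_unitP; split => /=; first by rewrite mulr0.
  rewrite /sqnorm /= !exprMn expr0n/= mulr0 add0r -!mulrDr -n2 exprVn mulVf//.
  by rewrite expf_neq0.
by apply: quat_eqP => /=; field.
Qed.

Lemma qconjMl p : qconj p * p = (sqnorm p)%:A.
Proof. by apply: quat_eqP; rewrite /sqnorm /=; ring. Qed.

Definition dotq p q := qre p * qre q + qi p * qi q + qj p * qj q + qk p * qk q.

(** For q <> 0 the unit is p / q: it is purely imaginary because p is orthogonal
    to q, and it has norm 1 because p and q have the same norm. *)
Lemma orthogonal_imag_unit p q : sqnorm p = sqnorm q -> dotq p q = 0 ->
  exists2 I, imag_units I & p = I * q.
Proof.
move=> pq pq0.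
have [q0|q0] := eqVneq (sqnorm q) 0.
  have z s : sqnorm s = 0 -> s = 0.
    rewrite sqnormE => /eqP; rewrite sqrf_eq0 normr_eq0 => /eqP //.
  exists (Quat 0 1 0 0); first by apply/imag_unitP; rewrite /sqnorm/=; split => //; ring.
  have -> : p = 0 by apply: z; rewrite pq.
  have -> : q = 0 by exact: z.
  by rewrite mulr0.
exists ((sqnorm q)^-1 *: (p * qconj q)).
  apply/imag_unitP; split => /=.
    by rewrite -[RHS](mulr0 (sqnorm q)^-1) -pq0 /dotq; ring.
  have -> : sqnorm ((sqnorm q)^-1 *: (p * qconj q)) =
    (sqnorm q)^-1 ^+ 2 * (sqnorm p * sqnorm q) by rewrite /sqnorm /=; ring.
  by rewrite pq; field.
by rewrite -scalerAl -mulrA qconjMl -scalerAr mulr1 scalerA mulVf// scale1r.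
Qed.

Lemma imag_unit_orthogonal I q : imag_units I ->
  sqnorm (I * q) = sqnorm q /\ dotq (I * q) q = 0.
Proof.
move=> hI; split; first by rewrite !sqnormE qnormM imag_unit_norm// mul1r.
by move/imag_unitP : hI => [h _]; rewrite /dotq /= h; ring.
Qed.

Lemma coord_le q : [/\ `|qre q| <= `|q|, `|qi q| <= `|q|, `|qj q| <= `|q| & `|qk q| <= `|q| ].
Proof.
have h (a : R) : a ^+ 2 <= sqnorm q -> `|a| <= `|q|.
  move=> ha; rewrite -(@ler_pXn2r _ 2)// ?nnegrE// real_normK ?num_real//.
  by rewrite -sqnormE.
have := sqr_ge0 (qre q); have := sqr_ge0 (qi q).
have := sqr_ge0 (qj q); have := sqr_ge0 (qk q) => *.
by split; apply: h; rewrite /sqnorm; lra.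
Qed.

Definition coords := [:: @qre R; @qi R; @qj R; @qk R].

Lemma quat_coord_ext p q : (forall l : quat R -> R, List.In l coords -> l p = l q) -> p = q.
Proof.
by move=> h; apply: quat_eqP; apply: h; rewrite /coords/=; tauto.
Qed.

Lemma coord_linear l : List.In l coords -> linear l /\ forall q, `|l q| <= `|q|.
Proof.
by rewrite /coords/= => -[<-|[<-|[<-|[<-|//]]]]; split => // q; have [] := coord_le q.
Qed.

End quaternion_algebra.

Section linear_maps.
Variable R : realType.

Lemma linear_at0 (V W : lmodType R) (f : V -> W) : linear f -> f 0 = 0.
Proof. by move=> lf; have := lf (-1) 0 0; rewrite !scaleN1r oppr0 addr0 addNr. Qed.

Lemma linear_scale (V W : lmodType R) (f : V -> W) (a : R) (x : V) : linear f ->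
  f (a *: x) = a *: f x.
Proof. by move=> lf; have := lf a x 0; rewrite (linear_at0 lf) !addr0. Qed.

Lemma bounded_linear_continuous (V W : normedModType R) (f : V -> W) (k : R) :
  linear f -> (forall x, `|f x| <= k * `|x|) -> continuous f.
Proof.
move=> lf fk.
move=> x; apply/cvgrPdist_lt => e e0; apply/nbhs_ballP.
have k0 : 0 < `|k| + 1 by rewrite ltr_wpDl.
exists (e / (`|k| + 1)) => /= [|y]; first exact: divr_gt0.
rewrite -ball_normE/= ltr_pdivlMr// => xy.
have -> : f x - f y = f (x - y).
  by have := lf (-1) y x; rewrite !scaleN1r ![- _ + _]addrC => ->.
apply: le_lt_trans (fk _) _; apply: le_lt_trans xy.
rewrite mulrC; apply: ler_wpM2l => //.
by apply: (le_trans (ler_norm k)); rewrite lerDl.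
Qed.

Lemma is_diff_bounded_linear (V W : normedModType R) (f : V -> W) (k : R) x :
  linear f -> (forall x, `|f x| <= k * `|x|) -> is_diff x f f.
Proof. by move=> lf fk; apply: is_diff_linear => //; exact: bounded_linear_continuous fk. Qed.

End linear_maps.

(** * Derivatives along a slice *)

Section slices.
Variable R : realType.
Implicit Types (I A q : quat R) (F : R -> R -> quat R) (l : quat R -> R).

Definition uncurry2 F (v : R * R) := F v.1 v.2.

Definition pdiffq F (p : R * R) A B := is_diff p (uncurry2 F) (fun v => v.1 *: A + v.2 *: B).

Lemma pdiffq_linear F p A B (g : quat R -> quat R) (k : R) : linear g ->
  (forall q, `|g q| <= k * `|q|) -> pdiffq F p A B ->
  pdiffq (fun x y => g (F x y)) p (g A) (g B).
Proof.
move=> lg gk dF.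
apply: (is_diff_eq (is_diff_comp dF (is_diff_bounded_linear (uncurry2 F p) lg gk))).
by apply/funext => v /=; rewrite lg (linear_scale _ _ lg).
Qed.

Lemma pdiffq_coord F p A B l : List.In l (coords R) -> pdiffq F p A B ->
  pdiff (fun v => l (F v.1 v.2)) p (l A) (l B).
Proof.
move=> hl dF; have [ll bl] := coord_linear hl.
have bl1 q : `|l q| <= 1 * `|q| by rewrite mul1r.
apply: (is_diff_eq (is_diff_comp dF (is_diff_bounded_linear (uncurry2 F p) ll bl1))).
by apply/funext => v /=; rewrite ll (linear_scale _ _ ll) /GRing.scale/= mulrC [v.2 * _]mulrC.
Qed.

Lemma pdiffqD F G p A B A' B' : pdiffq F p A B -> pdiffq G p A' B' ->
  pdiffq (fun x y => F x y + G x y) p (A + A') (B + B').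
Proof.
move=> dF dG; apply: (is_diff_eq (is_diffD dF dG)).
by apply/funext => v; rewrite !fctE !scalerDr addrACA.
Qed.

Lemma pdiffqB F G p A B A' B' : pdiffq F p A B -> pdiffq G p A' B' ->
  pdiffq (fun x y => F x y - G x y) p (A - A') (B - B').
Proof.
move=> dF dG; apply: (is_diff_eq (is_diffB dF dG)).
by apply/funext => v; rewrite !fctE !scalerBr opprD addrACA.
Qed.

Lemma pdiffq_mull F p A B q : pdiffq F p A B ->
  pdiffq (fun x y => q * F x y) p (q * A) (q * B).
Proof.
apply: (@pdiffq_linear _ _ _ _ (fun u => q * u) `|q|) => [a u v|u].
  by rewrite mulrDr scalerAr.
by rewrite qnormM.
Qed.

Lemma pdiffqZ F p A B (a : R) : pdiffq F p A B ->
  pdiffq (fun x y => a *: F x y) p (a *: A) (a *: B).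
Proof.
apply: (@pdiffq_linear _ _ _ _ (fun u => a *: u) `|a|) => [b u v|u].
  by rewrite scalerDr !scalerA mulrC.
by rewrite normrZ.
Qed.

Lemma pdiffq_cst p A : pdiffq (fun _ _ => A) p 0 0.
Proof.
apply: (is_diff_eq (is_diff_cst A p)).
by apply/funext => v /=; rewrite !scaler0 addr0.
Qed.

Definition slice_point I (v : R * R) : quat R := v.1%:A + I * v.2%:A.

Lemma is_diff_slice_point I p : is_diff p (slice_point I) (slice_point I).
Proof.
apply: (@is_diff_bounded_linear _ _ _ _ (1 + `|I|)) => [a u v|v].
  rewrite /slice_point /= !scalerDl mulrDr scalerDr -!scalerA -scalerAr addrACA.
  by rewrite scalerAr.
have [v1 v2] : `|v.1| <= `|v| /\ `|v.2| <= `|v|.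
  by rewrite prod_normE/= !le_max !lexx orbT.
have n1 (a : R) : `|a%:A : quat R| = `|a|.
  rewrite normrZ; have -> : `|1 : quat R| = 1; last by rewrite mulr1.
  by apply/eqP; rewrite -(@eqrXn2 _ 2)// -sqnormE /sqnorm /=; apply/eqP; ring.
apply: (le_trans (ler_normD _ _)); rewrite qnormM !n1 mulrDl mul1r.
by apply: lerD => //; apply: ler_wpM2l.
Qed.

Variables (Omega : set (quat R)) (f : quat R -> quat R).
Hypothesis freg : cullen_regular Omega f.

(** The regularity equation on the slice of I, in the form d/dy = I d/dx. *)
Lemma regular_slice_diff I x y : imag_units I -> Omega (x%:A + I * y%:A) ->
  exists A, pdiffq (slice f I) (x, y) A (I * A).
Proof.
move=> hI Oq; have [df cr] := freg.
have dq := df _ Oq; set q := x%:A + I * y%:A in Oq dq.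
have dF : is_diff (x, y) (f \o slice_point I) ('d f q \o slice_point I).
  exact: is_diff_comp (is_diff_slice_point I (x, y)) (differentiableP dq).
have LI : 'd f q I = I * 'd f q 1.
  have := cr I hI x y Oq.
  have d1 : is_diff x (fun t : R => (t, y)) (fun t => (t, 0)).
    exact: is_diff_pair (is_diff_id x) (is_diff_cst y x).
  have d2 : is_diff y (fun t : R => (x, t)) (fun t => (0, t)).
    exact: is_diff_pair (is_diff_cst x y) (is_diff_id y).
  have e1 := is_diff_comp d1 dF; have e2 := is_diff_comp d2 dF.
  have -> : 'D_1 (slice f I ^~ y) x = 'd f q 1.
    rewrite deriveE; last exact: (@ex_diff _ _ _ _ _ _ _ e1).
    rewrite (@diff_val _ _ _ _ _ _ _ e1)/= /slice_point /= scale1r scale0r mulr0.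
    by rewrite addr0.
  have -> : 'D_1 (slice f I x) y = 'd f q I.
    rewrite deriveE; last exact: (@ex_diff _ _ _ _ _ _ _ e2).
    rewrite (@diff_val _ _ _ _ _ _ _ e2)/= /slice_point /= scale1r scale0r.
    by rewrite mulr1 add0r.
  move/eqP; rewrite scaler_eq0 invr_eq0 pnatr_eq0/= addr_eq0 => /eqP ->.
  by rewrite mulrN imag_unit_mul// opprK.
exists ('d f q 1); apply: (is_diff_eq dF); apply/funext => v /=.
by rewrite /slice_point linearD linearZ/= -scalerAr mulr1 linearZ/= LI.
Qed.

End slices.

(** * The stem functions of a regular function *)

Section stem.
Variable R : realType.
Notation C := R[i].
Implicit Types (I A q w : quat R) (F : R -> R -> quat R) (l : quat R -> R) (z : C).

Lemma coord_opp l q : List.In l (coords R) -> l (- q) = - l q.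
Proof. by move=> /coord_linear[ll _]; rewrite -scaleN1r (linear_scale _ _ ll) scaleN1r. Qed.

Lemma coord_sub l p q : List.In l (coords R) -> l (p - q) = l p - l q.
Proof.
by move=> /coord_linear[ll _]; have := ll (-1) q p; rewrite !scaleN1r ![- _ + _]addrC.
Qed.

(** For the complex structure q |-> I * q on the quaternions, the map q |-> l q
    - i l (I * q) is complex linear. It turns the regularity equation into
    the Cauchy-Riemann equations of a complex-valued function whose real
    part is the coordinate l of F. *)
Lemma holo_coord I F z A l : imag_units I -> List.In l (coords R) ->
  pdiffq F (Re z, Im z) A (I * A) ->
  holo (fun u => l (F (Re u) (Im u)) +i* (- l (I * F (Re u) (Im u)))) z.
Proof.
move=> hI hl dF; exists (l A +i* (- l (I * A))).
have dIF := pdiffq_mull I dF.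
split.
  by apply: pdiff_eq (pdiffq_coord hl dF) _ _ => /=; ring.
have := pdiffB (pdiff_cst (Re z, Im z) 0) (pdiffq_coord hl dIF).
under [X in pdiff X]funext do rewrite sub0r.
move=> h; apply: pdiff_eq h _ _ => /=; first ring.
by rewrite imag_unit_mul// coord_opp//; ring.
Qed.

(** The identity theorem on a slice, one coordinate at a time; zeros on the real
    axis near 0 cluster at 0. *)
Lemma slice_identity I F (r : R) : 0 < r -> imag_units I ->
  (forall x y, normc (x +i* y) < r -> exists A, pdiffq F (x, y) A (I * A)) ->
  (exists2 e : R, 0 < e & forall x, `|x| < e -> F x 0 = 0) ->
  forall x y, normc (x +i* y) < r -> F x y = 0.
Proof.
move=> r0 hI dF [e e0 F0] x y xyr; apply: quat_coord_ext => l hl.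
have l0 : l 0 = 0 by have [ll _] := coord_linear hl; exact: linear_at0 ll.
pose h z : C := l (F (Re z) (Im z)) +i* (- l (I * F (Re z) (Im z))).
have hh z : normc z < r -> holo h z.
  case: z => a b abr; have [A dA] := dF _ _ abr.
  exact: (@holo_coord I F (a +i* b) A l).
have acc : zeros_cluster h 0.
  move=> d d0; pose t := Num.min (d / 2) (e / 2).
  have t0 : 0 < t by rewrite lt_min !divr_gt0.
  have td : t < d by rewrite gt_min; apply/orP; left; lra.
  have te : t < e by rewrite gt_min; apply/orP; right; lra.
  exists t%:C; rewrite subr0 normcR gtr0_norm//; split => //.
    by rewrite (inj_eq (@complexI R)) gt_eqF.
  by rewrite /h /= F0 ?gtr0_norm// mulr0 l0 oppr0.
have n0 : normc (0 : C) < r by rewrite normc0.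
have := identity_disc hh n0 acc xyr.
by rewrite /h l0 /= => /(congr1 (@complex.Re R)).
Qed.

Lemma pdiffq_conj F x y A B : pdiffq F (x, - y) A B ->
  pdiffq (fun x y => F x (- y)) (x, y) A (- B).
Proof.
move=> dF.
have d1 : is_diff (x, y) (fun v : R * R => (v.1, - v.2)) (fun v => (v.1, - v.2)).
  apply: (@is_diff_bounded_linear _ _ _ _ 1) => [a u v|v].
    by apply/eqP; rewrite xpair_eqE/= eqxx/= opprD scalerN.
  by rewrite mul1r !prod_normE/= normrN.
apply: (is_diff_eq (is_diff_comp d1 dF)).
by apply/funext => v /=; rewrite scaleNr scalerN.
Qed.

Definition unit_i : quat R := Quat 0 1 0 0.

Lemma unit_iP : imag_units unit_i.
Proof. by apply/imag_unitP; rewrite /sqnorm/=; split => //; ring. Qed.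

Variables (r : R) (f : quat R -> quat R).
Hypotheses (r0 : 0 < r) (freg : cullen_regular (qball r) f).

(** The functions B and C for which f (x + y I) = B + I C, found by solving this
    equation with I = i and I = - i. *)
Definition stem_re x y : quat R := 2^-1 *: (slice f unit_i x y + slice f unit_i x (- y)).
Definition stem_im x y : quat R :=
  - (unit_i * (2^-1 *: (slice f unit_i x y - slice f unit_i x (- y)))).

Lemma regular_slice_pdiffq I x y : imag_units I -> normc (x +i* y) < r ->
  exists A, pdiffq (slice f I) (x, y) A (I * A).
Proof.
move=> hI xyr; apply: (regular_slice_diff freg hI).
by rewrite /qball/= norm_slice_point.
Qed.

(** The stem functions satisfy the Cauchy-Riemann equations dB/dx = dC/dy and
    dB/dy = - dC/dx, so that B + i C is holomorphic with values in the
    complexified quaternions. *)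
Lemma stem_pdiffq x y : normc (x +i* y) < r ->
  exists U V, pdiffq stem_re (x, y) U V /\ pdiffq stem_im (x, y) (- V) U.
Proof.
move=> xyr; have [A dA] := regular_slice_pdiffq unit_iP xyr.
have xyr' : normc (x +i* - y) < r by move: xyr; rewrite /normc sqrrN.
have [A' /pdiffq_conj dA'] := regular_slice_pdiffq unit_iP xyr'.
have dR := pdiffqZ 2^-1 (pdiffqD dA dA').
have := pdiffq_mull (- unit_i) (pdiffqZ 2^-1 (pdiffqB dA dA')).
rewrite [X in pdiffq X](_ : _ = stem_im); last first.
  by apply/funext => a; apply/funext => b; rewrite mulNr.
move=> dI; exists (2^-1 *: (A + A')), (2^-1 *: (unit_i * A - unit_i * A')).
split; first exact: dR.
have i2 q : unit_i * (unit_i * q) = - q by exact: imag_unit_mul unit_iP.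
have <- : - unit_i * (2^-1 *: (A - A')) = - (2^-1 *: (unit_i * A - unit_i * A')).
  by rewrite -scalerAr mulNr mulrBr scalerN.
have <- : - unit_i * (2^-1 *: (unit_i * A - - (unit_i * A'))) = 2^-1 *: (A + A').
  by rewrite -scalerAr mulNr opprK mulrDr !i2 opprD !opprK.
exact: dI.
Qed.

(** The representation formula: a regular function is determined by one slice.
    The difference of the two sides solves the regularity equation on the
    slice of I and vanishes on the real axis. *)
Lemma stem_slice I x y : imag_units I -> normc (x +i* y) < r ->
  slice f I x y = stem_re x y + I * stem_im x y.
Proof.
move=> hI xyr; apply/eqP; rewrite -subr_eq0; apply/eqP.
apply: (@slice_identity I
  (fun x y => slice f I x y - (stem_re x y + I * stem_im x y)) r) => //.
  move=> {xyr x y} x y xyr.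
  have [A dA] := regular_slice_pdiffq hI xyr.
  have [U [V [dU dV]]] := stem_pdiffq xyr.
  have := pdiffqB dA (pdiffqD dU (pdiffq_mull I dV)).
  have -> : I * A - (V + I * U) = I * (A - (U + I * - V)).
    by rewrite mulrBr mulrDr imag_unit_mul// opprK [V + _]addrC.
  by move=> h; eexists; exact: h.
exists 1 => // t _; rewrite /stem_re /stem_im oppr0 subrr scaler0 mulr0 oppr0 mulr0 addr0.
have half (q : quat R) : 2^-1 *: (q + q) = q.
  by rewrite (_ : q + q = 2 *: q) ?scalerA ?mulVf ?scale1r// scaler_nat mulr2n.
by rewrite half /slice scale0r !mulr0 subrr.
Qed.

Definition stem_coord l z : C := l (stem_re (Re z) (Im z)) +i* l (stem_im (Re z) (Im z)).

Lemma holo_stem_coord l z : List.In l (coords R) -> normc z < r -> holo (stem_coord l) z.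
Proof.
move=> hl zr.
have zr' : normc (Re z +i* Im z) < r by rewrite complex_eta.
have [U [V [dU dV]]] := stem_pdiffq zr'.
exists (l U +i* (- l V)); split.
  by apply: pdiff_eq (pdiffq_coord hl dU) _ _ => /=; ring.
by apply: pdiff_eq (pdiffq_coord hl dV) _ _ => /=; rewrite ?coord_opp//; ring.
Qed.

(** The quadratic form of the complexified quaternions at the stem function of f
    - w; its zeros are the spheres x + y S that meet the fibre of f over w. *)
Definition symmetrization w z : C := \sum_(l <- coords R) (stem_coord l z - (l w)%:C) ^+ 2.

Lemma holo_sum (g : (quat R -> R) -> C -> C) z s :
  (forall l, List.In l s -> holo (g l) z) -> holo (fun u => \sum_(l <- s) g l u) z.
Proof.
elim: s => [|l s IH] h.
  by under [X in holo X]funext do rewrite big_nil; exact: holo_cst.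
under [X in holo X]funext do rewrite big_cons.
by apply: holoD; [apply: h; left|apply: IH => k ks; apply: h; right].
Qed.

Lemma holo_symmetrization w z : normc z < r -> holo (symmetrization w) z.
Proof.
move=> zr; apply: holo_sum => l hl.
under [X in holo X]funext do rewrite expr2.
by apply: holoM; apply: holoB; (exact: holo_cst || exact: holo_stem_coord).
Qed.

(** For the stem functions B and C, the real part of the symmetrization is |B -
    w| ^+ 2 - |C| ^+ 2 and the imaginary part is twice the inner product of
    B - w and C. *)
Lemma symmetrization_eq0 w z : symmetrization w z = 0 <->
  sqnorm (stem_re (Re z) (Im z) - w) = sqnorm (stem_im (Re z) (Im z)) /\
  dotq (stem_re (Re z) (Im z) - w) (stem_im (Re z) (Im z)) = 0.
Proof.
set a := stem_re _ _; set b := stem_im _ _.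
have -> : symmetrization w z =
  (sqnorm (a - w) - sqnorm b) +i* (2 * dotq (a - w) b).
  rewrite /symmetrization /coords !big_cons big_nil /stem_coord -/a -/b !expr2.
  by apply: complex_ext; rewrite /sqnorm /dotq /=; ring.
split=> [/eqP|[-> ->]]; last by rewrite subrr mulr0.
rewrite eq_complex /= => /andP[/eqP h1 /eqP h2]; split; first lra.
by move/eqP: h2; rewrite mulf_eq0 pnatr_eq0/= => /eqP.
Qed.

Lemma symmetrization_slice I w x y : imag_units I -> normc (x +i* y) < r ->
  slice f I x y = w -> symmetrization w (x +i* y) = 0.
Proof.
move=> hI xyr fw; apply/symmetrization_eq0 => /=.
have -> : stem_re x y - w = - (I * stem_im x y).
  by rewrite -fw (stem_slice hI xyr) opprD addrA subrr add0r.
have [h1 h2] := imag_unit_orthogonal (stem_im x y) hI.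
split; first by rewrite -h1 !sqnormE normrN.
by move: h2; rewrite /dotq /=; lra.
Qed.

(** If C <> 0, the equation B + I C = w is solved by I = (w - B) / C, which is
    an imaginary unit exactly when both components of the symmetrization vanish. *)
Lemma symmetrization_root w x y : normc (x +i* y) < r ->
  symmetrization w (x +i* y) = 0 -> exists2 I, imag_units I & slice f I x y = w.
Proof.
move=> xyr /symmetrization_eq0 /= [h1 h2].
have [I hI E] := orthogonal_imag_unit h1 h2.
have hNI : imag_units (- I).
  by move: hI; rewrite /imag_units/= sqrrN.
exists (- I) => //; by rewrite (stem_slice hNI xyr) mulNr -E opprB addrC subrK.
Qed.

(** Otherwise the symmetrization vanishes identically; on the real axis, where
    the spheres are points, this says f = w, and then f = w on every slice. *)
Lemma symmetrization_isolated w z : ~ constant_on (qball r) f -> normc z < r ->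
  ~ zeros_cluster (symmetrization w) z.
Proof.
move=> nc zr acc; apply: nc; exists w => q qr.
have N0 := identity_disc (fun u => @holo_symmetrization w u) zr acc.
have fr x : `|x| < r -> f x%:A = w.
  move=> xr; have xr' : normc (x +i* 0) < r by rewrite -[x +i* 0]/(x%:C) normcR.
  have [I hI] := symmetrization_root xr' (N0 _ xr').
  by rewrite /slice scale0r mulr0 addr0.
have [I [x [y [hI qE]]]] := exists_slice q.
move: qr; rewrite /qball/= qE norm_slice_point// => xyr.
apply/eqP; rewrite -subr_eq0; apply/eqP.
apply: (@slice_identity I (fun x y => slice f I x y - w) r) => //.
  move=> a b abr; have [A dA] := regular_slice_pdiffq hI abr.
  exists A; have := pdiffqB dA (pdiffq_cst (a, b) w).
  by rewrite !subr0.
by exists r => // t tr; rewrite /slice scale0r mulr0 addr0 fr// subrr.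
Qed.

End stem.

(** * Openness *)

Section openness.
Variable R : realType.
Notation C := R[i].
Implicit Types (I A q w c : quat R) (l : quat R -> R) (z : C).
Variables (r : R) (f : quat R -> quat R).
Hypotheses (r0 : 0 < r) (freg : cullen_regular (qball r) f).

Lemma pdiffq_near (F : R -> R -> quat R) x y A B (e : R) : pdiffq F (x, y) A B -> 0 < e ->
  exists2 d, 0 < d & forall a b, `|a - x| < d -> `|b - y| < d -> `|F a b - F x y| < e.
Proof.
move=> dF e0.
have /differentiable_continuous := @ex_diff _ _ _ _ _ _ _ dF.
move=> /cvgrPdist_lt/(_ _ e0)/nbhs_ballP[d /= d0 h]; exists d => // a b ad bd.
rewrite distrC; apply: (h (a, b)).
by rewrite /ball/= /prod_ball/= -!ball_normE/= !(distrC _ a) !(distrC _ b).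
Qed.

Lemma list_bound (T : Type) (g : (quat R -> R) -> T -> R) (D : T -> Prop) s :
  (forall l, List.In l s -> exists M, forall t, D t -> g l t <= M) ->
  exists2 M, 0 <= M & forall l, List.In l s -> forall t, D t -> g l t <= M.
Proof.
elim: s => [|l s IH] h; first by exists 0.
have [|M M0 hM] := IH; first by move=> k ks; apply: h; right.
have [K hK] := h l (or_introl erefl).
exists (Num.max M K) => [|k [<-|ks] t Dt]; rewrite le_max.
- by rewrite M0.
- by rewrite hK// orbT.
- by rewrite hM.
Qed.

(** Difference of two squares in each of the four coordinates. *)
Lemma symmetrization_perturb w c z (M : R) :
  (forall l, List.In l (coords R) -> normc (stem_coord f l z - (l c)%:C) <= M) ->
  normc (symmetrization f w z - symmetrization f c z) <=
  4 * (`|w - c| * (2 * M + `|w - c|)).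
Proof.
move=> hM.
have one l : List.In l (coords R) ->
    normc ((stem_coord f l z - (l w)%:C) ^+ 2 - (stem_coord f l z - (l c)%:C) ^+ 2) <=
    `|w - c| * (2 * M + `|w - c|).
  move=> hl; set g := stem_coord f l z - (l c)%:C.
  have wcl : normc (l (w - c))%:C <= `|w - c|.
    by rewrite normcR; have [_] := coord_linear hl; apply.
  have -> : (stem_coord f l z - (l w)%:C) ^+ 2 - g ^+ 2 =
     (l (w - c))%:C * ((l (w - c))%:C - 2%:R%:C * g).
    rewrite coord_sub// rmorphB /g rmorph_nat; ring.
  rewrite normcM; apply: ler_pM => //; rewrite ?normc_ge0//.
  apply: (le_trans (le_normcB _ _)); rewrite addrC; apply: lerD => //.
  by rewrite normcM normcR ger0_norm// ler_wpM2l//; exact: hM.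
rewrite /symmetrization /coords !big_cons !big_nil !addr0.
set a1 := (_ - _) ^+ 2; set a2 := (_ - _) ^+ 2; set a3 := (_ - _) ^+ 2; set a4 := (_ - _) ^+ 2.
set b1 := (_ - _) ^+ 2; set b2 := (_ - _) ^+ 2; set b3 := (_ - _) ^+ 2; set b4 := (_ - _) ^+ 2.
have -> : a1 + (a2 + (a3 + a4)) - (b1 + (b2 + (b3 + b4))) =
   (a1 - b1) + ((a2 - b2) + ((a3 - b3) + (a4 - b4))) by ring.
have [h1 h2 h3 h4] : [/\ normc (a1 - b1) <= `|w - c| * (2 * M + `|w - c|),
    normc (a2 - b2) <= `|w - c| * (2 * M + `|w - c|),
    normc (a3 - b3) <= `|w - c| * (2 * M + `|w - c|) &
    normc (a4 - b4) <= `|w - c| * (2 * M + `|w - c|)].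
  by split; apply: one; rewrite /coords/=; tauto.
have := normc_triangle (a1 - b1) ((a2 - b2) + ((a3 - b3) + (a4 - b4))).
have := normc_triangle (a2 - b2) ((a3 - b3) + (a4 - b4)).
have := normc_triangle (a3 - b3) (a4 - b4).
lra.
Qed.

(** Hurwitz's argument: on a small circle about the isolated zero z0 the
    symmetrization for c stays away from 0, and this persists for w close to
    c, while its value at z0 becomes small. *)
Lemma symmetrization_zero_stable c z0 (e : R) : ~ constant_on (qball r) f ->
  normc z0 < r -> symmetrization f c z0 = 0 -> 0 < e ->
  exists2 d, 0 < d & forall w, `|w - c| < d ->
    exists z, [/\ normc (z - z0) < e, normc z < r & symmetrization f w z = 0].
Proof.
move=> nc z0r N0 e0.
have /existsNP[e1 /not_implyP[e10 hiso]] := symmetrization_isolated r0 freg (w := c) nc z0r.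
have iso z : z != z0 -> normc (z - z0) < e1 -> symmetrization f c z != 0.
  by move=> zz0 ze; apply/eqP => Nz; apply: hiso; exists z.
have [p [p0 pe pe1 pr]] : exists p : R, [/\ 0 < p, p < e, p < e1 & normc z0 + p < r].
  pose m := Num.min e (Num.min e1 (r - normc z0)).
  have m0 : 0 < m by rewrite !lt_min e0 e10 subr_gt0 z0r.
  have me : m <= e by rewrite ge_min lexx.
  have me1 : m <= e1 by rewrite !ge_min lexx /= ?orbT.
  have mr : m <= r - normc z0 by rewrite !ge_min lexx /= ?orbT.
  by exists (m / 2); split; lra.
have pin z : normc (z - z0) <= p -> normc z < r.
  move=> zp; rewrite -(subrK z0 z); apply: (le_lt_trans (normc_triangle _ _)); lra.
pose g t : C := z0 + p%:C * expi t.
have gz t : g t - z0 = p%:C * expi t by rewrite /g; ring.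
have ng t : normc (g t - z0) = p.
  by rewrite gz normcM normc_expi mulr1 normcR gtr0_norm.
have cg : ccontinuous g.
  apply: ccontinuousD; first exact: ccontinuous_cst.
  by apply: ccontinuousM; [exact: ccontinuous_cst|exact: ccontinuous_expi].
have gr t : normc (g t) < r by apply: pin; rewrite ng.
have [m m0 hm] : exists2 m, 0 < m &
    forall t, 0 <= t <= pi *+ 2 -> m <= normc (symmetrization f c (g t)).
  apply: ccontinuous_min => [|t].
    by apply: (ccontinuous_comp cg) => t; exact: (holo_symmetrization freg c (gr t)).
  apply: iso; last by rewrite ng.
  apply/eqP => E; have := ng t; rewrite E subrr normc0 => E'.
  by rewrite -E' ltxx in p0.
have [M1 M10 hM1] := @list_bound R (fun l t => normc (stem_coord f l (g t) - (l c)%:C))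
   (fun t => 0 <= t <= pi *+ 2) (coords R) (fun l hl =>
   let: ex_intro2 M _ hM := ccontinuous_bounded (ccontinuousB
     (ccontinuous_comp cg (fun t => holo_stem_coord freg hl (gr t)))
     (ccontinuous_cst _)) in ex_intro _ M hM).
have b2 l : List.In l (coords R) -> exists M, forall u : unit, True ->
    normc (stem_coord f l z0 - (l c)%:C) <= M.
  by move=> _; exists (normc (stem_coord f l z0 - (l c)%:C)).
have [M2 M20 hM2] := @list_bound unit (fun l _ => normc (stem_coord f l z0 - (l c)%:C))
   (fun _ => True) (coords R) b2.
pose M := M1 + M2.
have M0 : 0 <= M by exact: addr_ge0.
have M1M : M1 <= M by rewrite lerDl.
have M2M : M2 <= M by rewrite lerDr.
pose k := 2 * M + 1.
have k0 : 0 < k by rewrite ltr_wpDl// mulr_ge0.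
exists (Num.min 1 (m / (32 * k))).
  by rewrite lt_min ltr01 divr_gt0// mulr_gt0.
move=> w; rewrite lt_min => /andP[wc1 wc].
(* An error of m / 8 leaves more than m / 2 on the circle, and twice this error
   is below m / 2 at z0. *)
have small : 4 * (`|w - c| * (2 * M + `|w - c|)) <= m / 8.
  move: wc; rewrite ltr_pdivlMr ?mulr_gt0// => wc.
  have : `|w - c| * (2 * M + `|w - c|) <= `|w - c| * k.
    by apply: ler_wpM2l => //; rewrite /k lerD2l ltW.
  lra.
have pert z : (forall l, List.In l (coords R) -> normc (stem_coord f l z - (l c)%:C) <= M) ->
    normc (symmetrization f w z - symmetrization f c z) <= m / 8.
  by move=> h; exact: le_trans (symmetrization_perturb _ h) small.
have [|||z zp Nz] := @zero_in_disc R (symmetrization f w) z0 p (m / 2) p0.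
- by move=> z zp; exact: (holo_symmetrization freg w (pin z zp)).
- move=> t ht.
  have := pert (g t) (fun l hl => le_trans (hM1 l hl t ht) M1M).
  have := hm t ht; have := le_distc (symmetrization f c (g t)) (symmetrization f w (g t)).
  by rewrite [normc (_ - symmetrization f w _)]normcB -/(g t); lra.
- have := pert z0 (fun l hl => le_trans (hM2 l hl tt Logic.I) M2M).
  by rewrite N0 subr0; lra.
by exists z; split; [exact: le_lt_trans pe|exact: pin|].
Qed.

(** For w close to f q, a zero z of the symmetrization close to that of f q
    yields I and a point p = x + y I of the fibre over w. It is close to q:
    if q is not real then C does not vanish at the sphere of q, as f is not
    constant on it, and I - I0 is controlled by (I - I0) * C, a combination
    of the small increments of w, B and C. If q is real, the unit I has no
    influence on the distance. *)
Lemma regular_open_at q (e : R) : ~ constant_on (qball r) f -> qball r q ->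
  ~ degenerate_set (qball r) f q -> 0 < e ->
  exists2 d, 0 < d & forall w, `|w - f q| < d ->
    exists p, [/\ `|p - q| < e, qball r p & f p = w].
Proof.
move=> nc qr ndq e0.
have [I0 [x0 [y0 [hI0 qE]]]] := exists_slice q.
have zr : normc (x0 +i* y0) < r by rewrite -(norm_slice_point x0 y0 hI0) -qE.
have fq : slice f I0 x0 y0 = f q by rewrite qE.
have [U [V [dS dT]]] := stem_pdiffq freg zr.
set S := stem_re f in dS; set T := stem_im f in dT.
(* Either the sphere through q is a point and y0 = 0, or T x0 y0 <> 0 because
   f is not constant on that sphere. *)
have [k k0 hk] : exists2 k : R, 0 <= k &
    forall I, `|I - I0| * `|y0| <= k * `|(I - I0) * T x0 y0|.
  have [y00|y0n] := eqVneq y0 0.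
    by exists 0 => // I; rewrite y00 normr0 mulr0 mul0r.
  have T0 : 0 < `|T x0 y0|.
    rewrite normr_gt0; apply/eqP => T0; apply: ndq; exists (x0, y0) => /=; last first.
      by exists I0 => //; rewrite qE -scalerAl mul1r -scalerAr mulr1.
    have sE I : x0%:A + y0%:A * I = x0%:A + I * y0%:A.
      by rewrite -scalerAl mul1r -scalerAr mulr1.
    split => //.
      by move=> _ [I hI <-]; rewrite /qball/= sE norm_slice_point.
    exists (S x0 y0) => _ [I hI <-]; rewrite sE -/(slice f I x0 y0).
    by rewrite (stem_slice r0 freg hI zr) -/T T0 mulr0 addr0.
  exists (`|y0| / `|T x0 y0|) => [|I]; first by rewrite divr_ge0.
  by rewrite qnormM le_eqVlt; apply/orP; left; apply/eqP; field; exact: lt0r_neq0.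
pose s := e / (2 * (3 * k + 1)).
have k1 : 0 < 3 * k + 1 by rewrite ltr_wpDl// mulr_ge0.
have s0 : 0 < s by rewrite divr_gt0// mulr_gt0.
have [d1 d10 hS] := pdiffq_near dS s0.
have [d2 d20 hT] := pdiffq_near dT s0.
pose t := Num.min (e / 2) (Num.min d1 d2).
have t0 : 0 < t by rewrite !lt_min divr_gt0// d10.
have N0 := symmetrization_slice r0 freg hI0 zr fq.
have [d d0 hd] := symmetrization_zero_stable nc zr N0 t0.
exists (Num.min d s); first by rewrite lt_min d0.
move=> w; rewrite lt_min => /andP[wd ws].
have [[x y] [zt zr' Nz]] := hd w wd.
have [I hI fI] := symmetrization_root r0 freg zr' Nz.
exists (x%:A + I * y%:A); split; [|by rewrite /qball/= norm_slice_point|exact: fI].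
move: zt; rewrite !lt_min => /andP[zte /andP[zt1 zt2]].
have xx : `|x - x0| <= normc (x +i* y - (x0 +i* y0)) := Re_le (x +i* y - (x0 +i* y0)).
have yy : `|y - y0| <= normc (x +i* y - (x0 +i* y0)) := Im_le (x +i* y - (x0 +i* y0)).
have {}hS := hS x y (le_lt_trans xx zt1) (le_lt_trans yy zt1).
have {}hT := hT x y (le_lt_trans xx zt2) (le_lt_trans yy zt2).
have E : (I - I0) * T x0 y0 = (w - f q) - (S x y - S x0 y0) - I * (T x y - T x0 y0).
  rewrite -fI -fq (stem_slice r0 freg hI zr') (stem_slice r0 freg hI0 zr) -/S -/T.
  rewrite mulrBl mulrBr.
  move: (S x y) (S x0 y0) (I * T x y) (I * T x0 y0) (I0 * T x0 y0) => a1 a2 a3 a4 a5.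
  by apply: quat_eqP => /=; ring.
have bI : `|(I - I0) * T x0 y0| < 3 * s.
  rewrite E; apply: (le_lt_trans (ler_normB _ _)); rewrite qnormM imag_unit_norm// mul1r.
  have := ler_normB (w - f q) (S x y - S x0 y0); lra.
have -> : x%:A + I * y%:A - q = ((x - x0)%:A + I * (y - y0)%:A) + (I - I0) * y0%:A.
  by rewrite qE; apply: quat_eqP => /=; ring.
apply: (le_lt_trans (ler_normD _ _)); rewrite norm_slice_point//.
have -> : `|(I - I0) * y0%:A| = `|I - I0| * `|y0|.
  by rewrite -scalerAr mulr1 normrZ mulrC.
have := hk I.
have : k * `|(I - I0) * T x0 y0| <= k * (3 * s) by apply: ler_wpM2l => //; exact: ltW.
have : k * (3 * s) < e / 2.
  by rewrite /s !mulrA ltr_pdivrMr ?mulr_gt0//; lra.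
move: zte; rewrite -[(x +i* y) - _]/((x - x0) +i* (y - y0)); lra.
Qed.

End openness.

Local Close Scope complex_scope.
Unset Implicit Arguments.

Theorem theorem1p4 (R : realType) (r : R) (f : quat R -> quat R) :
  0 < r ->
  cullen_regular (qball r) f ->
  ~ constant_on (qball r) f ->
  open_map_on (qball r `\` closure (degenerate_set (qball r) f)) f.
Proof.
move=> r0 freg nc U oU; rewrite openE => _ [q [Uq [qr nq]] <-].
have oW : open (U `&` (qball r `\` closure (degenerate_set (qball r) f))).
  apply: openI => //; rewrite setDE; apply: openI; last first.
    by apply: closed_openC; exact: closed_closure.
  have -> : qball r = ball (0 : quat R) r.
    by rewrite -ball_normE; apply/seteqP; split => p; rewrite /qball/= sub0r normrN.
  exact: ball_open.
have := open_nbhs_nbhs (conj oW (conj Uq (conj qr nq))).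
move=> /nbhs_ballP[e /= e0 he].
have ndq : ~ degenerate_set (qball r) f q by move=> dq; apply: nq; exact: subset_closure.
have [d d0 hd] := regular_open_at r0 freg nc qr ndq e0.
apply/nbhs_ballP; exists d => //= w; rewrite -ball_normE/= distrC => wd.
have [p [pq pr fp]] := hd w wd.
by exists p => //; apply: he; rewrite -ball_normE/= distrC.
Qed.
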